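(* Let $a<b$ be integers, $\mathbf{I}=\{a,\dots,b\}$, $\mathbf{I}^*=\{a+\tfrac12,\dots,b-\tfrac12\}$ and $\beta>0$. Let $P_\beta^{\mathbb{C}}:(\mathbb{C}^2)^{\mathbf{I}^*}\to(\mathbb{C}^2)^{\mathbf{I}^*}$ be the complexified massive s-holomorphic row-to-row propagator, and let $W_\circ\subset(\mathbb{C}^2)^{\mathbf{I}^*}$ be the subspace spanned by the eigenvectors of $P_\beta^{\mathbb{C}}$ with eigenvalues less than one. On the exterior algebra $\bigwedge W_\circ=\bigoplus_{n=0}^{|\mathbf{I}^*|}\wedge^nW_\circ$ define $\Gamma(P_\beta^{\mathbb{C}})=\bigoplus_{n=0}^{|\mathbf{I}^*|}(P_\beta^{\mathbb{C}}|_{W_\circ})^{\otimes n}$ (the operator $w_1\wedge\dots\wedge w_n\mapsto P_\beta^{\mathbb{C}}w_1\wedge\dots\wedge P_\beta^{\mathbb{C}}w_n$). Let $V$ be the Ising transfer matrix at inverse temperature $\beta$, restricted to $\mathcal{S}_+$. Then there are a linear isomorphism $\rho:\mathcal{S}_+\to\bigwedge W_\circ$ and a constant $\Lambda_0>0$ such that $$\rho\circ V\circ\rho^{-1}=\Lambda_0\,\Gamma(P_\beta^{\mathbb{C}}).$$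
   Context: **Transfer matrix.** $\mathcal{S}$ is the complex vector space with basis $(\mathbf{e}_\sigma)_{\sigma\in\{\pm1\}^{\mathbf{I}}}$. $V=(V^{h})^{1/2}V^{v}(V^{h})^{1/2}$, where $V^v_{\sigma\rho}=\exp(\beta\sum_{i=a}^b\sigma_i\rho_i)$ if $\sigma_a=\rho_a$ and $\sigma_b=\rho_b$, and $V^v_{\sigma\rho}=0$ otherwise; $(V^h)^{1/2}$ is diagonal with entries $\exp(\frac{\beta}{2}\sum_{i=a}^{b-1}\sigma_i\sigma_{i+1})$. $\mathcal{S}_+=\mathrm{span}\{\mathbf{e}_\sigma:\sigma_b=+1\}$ is invariant under $V$. **Massive s-holomorphicity.** Edges of the square lattice are identified with their midpoints in $\mathbb{C}$. Set $\lambda=e^{i\pi/4}$, $\alpha=e^{-2\beta}$, $\nu=\lambda^{-3}\frac{\alpha+i}{\alpha-i}$. A function $F$ on the edges is massive s-holomorphic (parameter $\beta$) on a face with center $c$ and edges $E=c+\frac12$, $N=c+\frac i2$, $W=c-\frac12$, $S=c-\frac i2$ if $F(N)+\nu^{-1}\lambda\overline{F(N)}=\nu^{-1}F(E)+\lambda\overline{F(E)}$, $F(N)+\nu\lambda^{-1}\overline{F(N)}=\nu F(W)+\lambda^{-1}\overline{F(W)}$, $F(S)+\nu\lambda^{3}\overline{F(S)}=\nu F(E)+\lambda^{3}\overline{F(E)}$, $F(S)+\nu^{-1}\lambda^{-3}\overline{F(S)}=\nu^{-1}F(W)+\lambda^{-3}\overline{F(W)}$. **Propagator.** Write $\mathbf{I}^*_y=\{k+iy:k\in\mathbf{I}^*\}$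 and $\mathbf{I}_{1/2}=\{x+\frac i2:x\in\mathbf{I}\}$. Every $f:\mathbf{I}^*_0\to\mathbb{C}$ has a unique extension $h$ to $\mathbf{I}^*_0\cup\mathbf{I}_{1/2}\cup\mathbf{I}^*_1$ that is massive s-holomorphic on all faces $k+\frac i2$, $k\in\mathbf{I}^*$, and satisfies the Riemann boundary condition $h\parallel\tau_{cw}^{-1/2}$ on the two vertical boundary edges ($\tau_{cw}$ the clockwise unit tangent of the box), i.e. $h(a+\frac i2)\in\mathbb{R}\lambda^{-1}$ and $h(b+\frac i2)\in\mathbb{R}\lambda$. With $\mathbb{C}\cong\mathbb{R}^2$, $P_\beta:(\mathbb{R}^2)^{\mathbf{I}^*}\to(\mathbb{R}^2)^{\mathbf{I}^*}$ is the real-linear map $f\mapsto h|_{\mathbf{I}^*_1}$; $P_\beta^{\mathbb{C}}$ is its complex-linear extension. It is diagonalizable with positive real eigenvalues different from $1$. *)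

(* Defs.v *)
From HB Require Import structures.
From mathcomp Require Import all_boot all_order all_fingroup all_algebra.
From mathcomp Require Import complex ring.
From mathcomp Require Import boolp classical_sets reals sequences exp trigo.

Set Implicit Arguments.
Unset Strict Implicit.
Unset Printing Implicit Defensive.

Import Order.TTheory GRing.Theory Num.Theory.

Local Open Scope ring_scope.
Local Open Scope complex_scope.
Local Open Scope classical_set_scope.

Lemma linfunE (K : fieldType) (aT rT : vectType K) (f : aT -> rT) :
  linear f -> linfun f =1 f.
Proof.
move=> lf x.
pose g := HB.pack_for {linear aT -> rT} f (GRing.isLinear.Build K aT rT *:%R f lf).
exact: (lfunE g x).
Qed.

Section LinearAlgebra.
Variables (K : fieldType) (vT : vectType K).

Definition is_span (A : set vT) (U : {vspace vT}) : Prop :=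
  (forall v, A v -> v \in U) /\
  (forall U' : {vspace vT}, (forall v, A v -> v \in U') -> (U <= U')%VS).

(* the linear span of an arbitrary (possibly infinite) set of vectors *)
Definition vspan (A : set vT) : {vspace vT} := xget 0%VS [set U | is_span A U].

Lemma vspanP (A : set vT) : is_span A (vspan A).
Proof.
suff [U UP] : exists U, is_span A U by rewrite /vspan; case: xgetP => // /(_ U).
suff H k (U0 : {vspace vT}) : (dim vT - \dim U0 <= k)%N ->
    (forall U' : {vspace vT}, (forall v, A v -> v \in U') -> (U0 <= U')%VS) ->
    exists U, is_span A U.
  by apply: (H (dim vT) 0%VS); [rewrite leq_subr | move=> *; rewrite sub0v].
elim: k U0 => [|k IHk] U0 dimU0 minU0.
  exists U0; split=> // v _.
  suff -> : U0 = fullv by rewrite memvf.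
  by apply/eqP; rewrite eqEdim subvf dimvf -subn_eq0 -leqn0.
have [AU0|] := pselect (forall v, A v -> v \in U0); first by exists U0.
move=> /existsNP[v /not_implyP[Av /negP vU0]].
apply: (IHk (U0 + <[v]>)%VS) => [|U' AU']; last first.
  by rewrite subv_add minU0 //= -memvE AU'.
have ltU0 : (\dim U0 < \dim (U0 + <[v]>))%N.
  rewrite (ltn_leqif (dimv_leqif_sup (addvSl _ _))).
  by rewrite subv_add subvv -memvE.
by move: dimU0; rewrite !leq_subLR => /leq_trans; apply; rewrite addnS -addSn leq_add2r.
Qed.

(* The projection plays no role when [U] is [f]-stable, see [restrE]. *)
Definition restr (U : {vspace vT}) (f : 'End(vT)) : 'End(subvs_of U) :=
  linfun (fun x : subvs_of U => vsproj U (f (vsval x))).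

Lemma restrE (U : {vspace vT}) (f : 'End(vT)) (x : subvs_of U) :
  (f @: U <= U)%VS -> vsval (restr U f x) = f (vsval x).
Proof.
move=> fU; rewrite linfunE => [|c y z]; last by rewrite !linearP.
by rewrite vsprojK // (subvP fU) // memv_img ?subvsP.
Qed.

End LinearAlgebra.

Section ExteriorAlgebra.
Variables (K : fieldType) (J : finType).

Local Notation X := {ffun J -> K^o}.
(* the n-th tensor power of K^J, in the basis of pure tensors of basis vectors *)
Local Notation tens n := {ffun n.-tuple J -> K^o}.

Definition basis_vec (j : J) : X := [ffun j' => (j' == j)%:R].

Lemma basis_vec_sum (x : X) : x = \sum_j x j *: basis_vec j.
Proof.
apply/ffunP=> i; rewrite sum_ffunE (bigD1 i) //= !ffunE eqxx.
rewrite big1 ?addr0 => [|k ki]; first by rewrite /GRing.scale /= mulr1.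
by rewrite !ffunE eq_sym (negPf ki) scaler0.
Qed.

Lemma basis_vec_spanP (P : pred J) (x : X) :
  reflect (forall j, ~~ P j -> x j = 0)
          (x \in (\sum_(j | P j) <[basis_vec j]>)%VS).
Proof.
apply: (iffP idP) => [/memv_sumP[y yP ->] j Pj|x0].
  rewrite sum_ffunE big1 // => i Pi; have /vlineP[k ->] := yP i Pi.
  by rewrite !ffunE; case: eqP Pj => [->|]; rewrite ?Pi ?scaler0.
rewrite [x]basis_vec_sum; apply: rpred_sum => j _; have [Pj|Pj] := boolP (P j).
  by apply: (subvP (sumv_sup j Pj (subvv _))); rewrite memvZ // memv_line.
by rewrite x0 // scale0r mem0v.
Qed.

Definition tpow (n : nat) (f : 'End(X)) : 'End(tens n) :=
  linfun (fun x : tens n =>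
    [ffun t => \sum_u (\prod_(i < n) f (basis_vec (tnth u i)) (tnth t i)) * x u]
    : tens n).

(* w_1 /\ ... /\ w_n as an antisymmetric tensor; this realizes the exterior
   powers faithfully in characteristic 0. *)
Definition wedge (n : nat) (w : 'I_n -> X) : tens n :=
  [ffun t => \sum_(s : 'S_n) (-1) ^+ s * \prod_(i < n) w (s i) (tnth t i)].

Definition extpow (n : nat) (W : {vspace X}) : {vspace tens n} :=
  vspan [set x | exists2 w : 'I_n -> X, (forall i, w i \in W) & x = wedge w].

Lemma tpowE n f (x : tens n) t : tpow n f x t =
  \sum_u (\prod_(i < n) f (basis_vec (tnth u i)) (tnth t i)) * x u.
Proof.
rewrite linfunE ?ffunE // => c y z; apply/ffunP=> t'; rewrite !ffunE.
rewrite scaler_sumr -big_split; apply: eq_bigr => u _ /=.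
by rewrite !ffunE mulrDr mulrCA.
Qed.

Lemma tpow_wedge n f (w : 'I_n -> X) : tpow n f (wedge w) = wedge (f \o w).
Proof.
have fE (v : X) j : f v j = \sum_j' f (basis_vec j') j * v j'.
  rewrite {1}(basis_vec_sum v) linear_sum sum_ffunE; apply: eq_bigr => k _.
  by rewrite linearZ ffunE mulrC.
apply/ffunP=> t; rewrite tpowE ffunE.
under eq_bigr => u _ do rewrite ffunE mulr_sumr.
rewrite exchange_big; apply: eq_bigr => s _ /=.
under [in RHS]eq_bigr => i _ do rewrite fE.
rewrite bigA_distr_bigA mulr_sumr /=.
rewrite (reindex (fun u : n.-tuple J => [ffun i => tnth u i])) /=; last first.
  exists (fun g : {ffun 'I_n -> J} => [tuple g i | i < n]) => u _.
    by apply: eq_from_tnth => i; rewrite tnth_mktuple ffunE.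
  by apply/ffunP=> i; rewrite ffunE tnth_mktuple.
apply: eq_bigr => u _; rewrite mulrCA -big_split /=; congr (_ * _).
by apply: eq_bigr => i _; rewrite ffunE.
Qed.

Variable d : nat.

(* The direct sum of the tensor powers of degree at most [d]: a family of
   coordinates indexed by the words of length at most [d] over [J]. *)
Local Notation word := {n : 'I_d.+1 & n.-tuple J}.
Local Notation T := {ffun word -> K^o}.

Definition degree (n : 'I_d.+1) : 'Hom(T, tens n) :=
  linfun (fun x : T =>
    [ffun t => x (Tagged (fun n : 'I_d.+1 => n.-tuple J) t)] : tens n).

Definition extalg (W : {vspace X}) : {vspace T} :=
  (\bigcap_(n < d.+1) (degree n @^-1: extpow n W))%VS.

Definition Gamma (f : 'End(X)) : 'End(T) :=
  linfun (fun x : T =>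
    [ffun u : word => tpow (tag u) f (degree (tag u) x) (tagged u)] : T).

Lemma degreeE n (x : T) t :
  degree n x t = x (Tagged (fun n : 'I_d.+1 => n.-tuple J) t).
Proof. by rewrite linfunE ?ffunE // => c y z; apply/ffunP=> u; rewrite !ffunE. Qed.

Lemma degree_Gamma n f (x : T) : degree n (Gamma f x) = tpow n f (degree n x).
Proof.
apply/ffunP=> t; rewrite degreeE linfunE ?ffunE // => c y z.
by apply/ffunP=> u; rewrite !ffunE !linearP /= !ffunE.
Qed.

Lemma Gamma_extalg (W : {vspace X}) f :
  (f @: W <= W)%VS -> (Gamma f @: extalg W <= extalg W)%VS.
Proof.
move=> fW; apply/subvP=> _ /memv_imgP[x xW ->].
rewrite /extalg memvE; apply/subv_bigcapP => n _.
rewrite -memvE -memv_preim degree_Gamma.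
move: xW; rewrite /extalg memvE => /subv_bigcapP/(_ n isT).
rewrite -memvE -memv_preim => xn.
have [in_n min_n] := vspanP [set x | exists2 w : 'I_n -> X,
  (forall i, w i \in W) & x = wedge w].
suff /subvP : (extpow n W <= tpow n f @^-1: extpow n W)%VS.
  by move=> /(_ _ xn); rewrite -memv_preim.
apply: min_n => _ [w wW ->]; rewrite -memv_preim tpow_wedge.
by apply: in_n; exists (f \o w) => // i; rewrite (subvP fW) ?memv_img.
Qed.

End ExteriorAlgebra.

Section Ising.
Variables (R : realType) (a b : int) (beta : R).

(* [i : 'I_m.+1] stands for the site [a + i] of {a, ..., b}, and the boolean
   [true] for the spin +1. *)
Local Notation m := (`|b - a|%N).
Local Notation config := {ffun 'I_m.+1 -> bool}.
Local Notation S := {ffun config -> R[i]^o}.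

Definition spin (s : bool) : R := if s then 1 else -1.

Definition Vv_entry (sigma rho : config) : R :=
  if (sigma ord0 == rho ord0) && (sigma ord_max == rho ord_max) then
    expR (beta * \sum_(i < m.+1) spin (sigma i) * spin (rho i))
  else 0.

Definition Vh_half_entry (sigma rho : config) : R :=
  if sigma == rho then
    expR (beta / 2 * \sum_(i < m)
      spin (sigma (widen_ord (leqnSn m) i)) * spin (sigma (lift ord0 i)))
  else 0.

Definition matrix_op (M : config -> config -> R) : 'End(S) :=
  linfun (fun x : S => [ffun sigma => \sum_rho (M sigma rho)%:C * x rho] : S).

Lemma matrix_opE M (x : S) sigma :
  matrix_op M x sigma = \sum_rho (M sigma rho)%:C * x rho.
Proof.
rewrite linfunE ?ffunE // => c y z; apply/ffunP=> s; rewrite !ffunE.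
rewrite scaler_sumr -big_split; apply: eq_bigr => r _ /=.
by rewrite !ffunE mulrDr mulrCA.
Qed.

Definition transfer : 'End(S) :=
  (matrix_op Vh_half_entry \o matrix_op Vv_entry \o matrix_op Vh_half_entry)%VF.

Definition Splus : {vspace S} :=
  (\sum_(sigma : config | sigma ord_max) <[basis_vec R[i] sigma]>)%VS.

Lemma transfer_Splus : (transfer @: Splus <= Splus)%VS.
Proof.
suff inv (M : config -> config -> R) :
    (forall s r : config, s ord_max != r ord_max -> M s r = 0) ->
    (matrix_op M @: Splus <= Splus)%VS.
  have h1 : (matrix_op Vh_half_entry @: Splus <= Splus)%VS.
    by apply: inv => s r; rewrite /Vh_half_entry; case: (s =P r) => // ->; rewrite eqxx.
  have h2 : (matrix_op Vv_entry @: Splus <= Splus)%VS.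
    by apply: inv => s r sr; rewrite /Vv_entry (negPf sr) andbF.
  rewrite /transfer !limg_comp.
  exact: subv_trans (limgS _ (subv_trans (limgS _ h1) h2)) h1.
move=> M0; apply/subvP => _ /memv_imgP[x xS ->].
apply/basis_vec_spanP => s sm; rewrite matrix_opE big1 // => r _.
have [rm|rm] := boolP (r ord_max); first by rewrite M0 ?mul0r // rm (negPf sm).
by rewrite (basis_vec_spanP _ _ xS r rm) mulr0.
Qed.

End Ising.

Section SHolomorphic.
Variables (R : realType) (beta : R).

Definition lambda : R[i] := cos (pi / 4) +i* sin (pi / 4).
Definition alpha : R := expR (- 2 * beta).
Definition nu : R[i] := lambda ^- 3 * ((alpha%:C + 'i%C) / (alpha%:C - 'i%C)).

Definition ms_holo (F : R[i] -> R[i]) (c : R[i]) : Prop :=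
  let E := F (c + 2^-1) in
  let N := F (c + 'i%C / 2) in
  let W := F (c - 2^-1) in
  let S := F (c - 'i%C / 2) in
  [/\ N + nu^-1 * lambda * N^*%C = nu^-1 * E + lambda * E^*%C,
      N + nu * lambda^-1 * N^*%C = nu * W + lambda^-1 * W^*%C,
      S + nu * lambda ^+ 3 * S^*%C = nu * E + lambda ^+ 3 * E^*%C
    & S + nu^-1 * lambda ^- 3 * S^*%C = nu^-1 * W + lambda ^- 3 * W^*%C].

End SHolomorphic.


Section Propagator.
Variables (R : realType) (a b : int) (beta : R).

Local Notation m := (`|b - a|%N).

(* [k : 'I_m] stands for the dual site [a + k + 1/2] of I^*; in (R^2)^{I^*} the
   second index selects the real or the imaginary part *)
Local Notation row := {ffun 'I_m * 'I_2 -> R^o}.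

Definition cvalue (f : row) (k : 'I_m) : R[i] := f (k, ord0) +i* f (k, ord_max).

Definition site (n : nat) : R := a%:~R + n%:R.

Definition dual_site (n : nat) : R := a%:~R + n%:R + 2^-1.

(* Edges are the points of R[i] that are their midpoints; [h] is constrained
   only at the edges of the row of faces between heights 0 and 1. *)
Definition is_extension (f : row) (h : R[i] -> R[i]) : Prop :=
  [/\ forall k : 'I_m, h (dual_site k +i* 0) = cvalue f k,
      forall k : 'I_m, ms_holo beta h (dual_site k +i* 2^-1),
      exists t : R, h (a%:~R +i* 2^-1) = t%:C * (lambda R)^-1
    & exists t : R, h (b%:~R +i* 2^-1) = t%:C * lambda R].

Definition is_propagation (f g : row) : Prop :=
  exists2 h, is_extension f h &
    forall k : 'I_m, h (dual_site k +i* 1) = cvalue g k.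

(* The default value is never used when [a < b] and [0 < beta], and the choice
   is unique: see [extension_exists_unique] and [propagation_unique]. *)
Definition propagator (f : row) : row := xget 0 [set g | is_propagation f g].

End Propagator.

Definition complexify (R : realType) (J : finType)
    (P : {ffun J -> R^o} -> {ffun J -> R^o}) : 'End({ffun J -> R[i]^o}) :=
  linfun (fun w : {ffun J -> R[i]^o} =>
    [ffun j => P [ffun j' => complex.Re (w j')] j +i* P [ffun j' => complex.Im (w j')] j]
    : {ffun J -> R[i]^o}).

Definition propagatorC (R : realType) (a b : int) (beta : R) :
    'End({ffun 'I_(`|b - a|%N) * 'I_2 -> R[i]^o}) :=
  complexify (@propagator R a b beta).

Definition Wcirc (R : realType) (a b : int) (beta : R) :
    {vspace {ffun 'I_(`|b - a|%N) * 'I_2 -> R[i]^o}} :=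
  vspan [set w | w != 0 /\
    exists2 mu : R, mu < 1 & propagatorC a b beta w = mu%:C *: w].
Section RealLinearEquations.

Lemma two_lines_field (F : fieldType) (c d e c' d' e' : F) :
    c != 0 -> d != 0 -> c' != 0 -> d' != 0 -> c * d' - c' * d != 0 ->
  (d'^-1 * (e / (c * d)) - d^-1 * (e' / (c' * d'))) / (c^-1 * d'^-1 - c'^-1 * d^-1)
  = (c * e' - c' * e) / (c * d' - c' * d).
Proof.
move=> c0 d0 c'0 d'0 D0.
have -> : c^-1 * d'^-1 - c'^-1 * d^-1
    = - (c * d' - c' * d) / (c * d' * (c' * d)).
  by field; rewrite c0 d0 c'0 d'0.
have -> : d'^-1 * (e / (c * d)) - d^-1 * (e' / (c' * d'))
    = - (c * e' - c' * e) / (c * d' * (c' * d)).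
  by field; rewrite c0 d0 c'0 d'0.
have M0 : c * d' * (c' * d) != 0 by rewrite !mulf_neq0.
move: (c * e' - c' * e) (c * d' - c' * d) (c * d' * (c' * d)) D0 M0 => N D M D0 M0.
by field; rewrite D0 M0 oppr_eq0.
Qed.

Variable R : realType.
Implicit Types c d e z : R[i].

(* [c z + d z^* = e] is one real equation as soon as [e = c d e^*]. *)
Lemma two_lines c d e c' d' e' :
    c * c^*%C = 1 -> d * d^*%C = 1 -> c' * c'^*%C = 1 -> d' * d'^*%C = 1 ->
    e = c * d * e^*%C -> e' = c' * d' * e'^*%C -> c * d' != c' * d ->
  exists z, [/\ c * z + d * z^*%C = e, c' * z + d' * z^*%C = e'
    & forall z', c * z' + d * z'^*%C = e -> c' * z' + d' * z'^*%C = e' -> z' = z].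
Proof.
move=> c1 d1 c'1 d'1 eE e'E; rewrite -subr_eq0 => D0.
have inv1 (x : R[i]) : x * x^*%C = 1 -> x != 0 /\ x^*%C = x^-1.
  move=> x1; have x0 : x != 0 by apply: contra_eq_neq x1 => ->; rewrite mul0r eq_sym oner_eq0.
  by split=> //; apply: (mulfI x0); rewrite x1 divff.
have [[c0 cc] [d0 dd]] := (inv1 _ c1, inv1 _ d1).
have [[c'0 c'c] [d'0 d'd]] := (inv1 _ c'1, inv1 _ d'1).
have ee : e^*%C = e / (c * d) by rewrite {2}eE mulrAC divff ?mul1r ?mulf_neq0.
have e'e : e'^*%C = e' / (c' * d') by rewrite {2}e'E mulrAC divff ?mul1r ?mulf_neq0.
have zJ : ((d' * e - d * e') / (c * d' - c' * d))^*%C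
    = (c * e' - c' * e) / (c * d' - c' * d).
  rewrite rmorphM fmorphV !rmorphB !rmorphM /= cc dd c'c d'd ee e'e.
  exact: two_lines_field.
exists ((d' * e - d * e') / (c * d' - c' * d)).
rewrite zJ; split=> [||z' <- <-]; rewrite ?mulrA -?mulrDl.
- by apply: canLR (mulfK D0) _; ring.
- by apply: canLR (mulfK D0) _; ring.
by apply: canRL (mulfK D0) _; ring.
Qed.

End RealLinearEquations.
Lemma conjcM (R : rcfType) (x y : R[i]) : (x * y)^*%C = x^*%C * y^*%C.
Proof. exact: rmorphM. Qed.

Lemma conjcX (R : rcfType) (x : R[i]) n : (x ^+ n)^*%C = x^*%C ^+ n.
Proof. exact: rmorphXn. Qed.

Section SHolomorphicTheory.
Variables (R : realType) (beta : R).
Hypothesis beta_gt0 : 0 < beta.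

Local Notation l := (lambda R).
Local Notation v := (nu beta).
Local Notation u := ((alpha beta)%:C + 'i%C).
Local Notation w := ((alpha beta)%:C - 'i%C).

Lemma lambda_conj : l * l^*%C = 1.
Proof.
rewrite /lambda; simpc; apply/eqP; rewrite eq_complex /= -!expr2 cos2Dsin2.
by rewrite eqxx [sin _ * _]mulrC addNr eqxx.
Qed.

Lemma lambda_sqr : l ^+ 2 = 'i%C.
Proof.
have e2 : (pi / 4 : R) *+ 2 = pi / 2 by field.
have := cos_mulr2n (pi / 4 : R); rewrite e2 cos_pihalf => /esym/eqP c2.
have := sin_mulr2n (pi / 4 : R); rewrite e2 sin_pihalf => s2.
rewrite expr2 /lambda; simpc; apply/eqP; rewrite eq_complex /=.
rewrite -!expr2 sin2cos2 opprB addrA -mulr2n c2 /=.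
by rewrite [X in _ + X]mulrC -mulr2n -s2 eqxx.
Qed.

Lemma lambda4 : l ^+ 4 = -1.
Proof. by rewrite (exprM _ 2 2) lambda_sqr sqr_i. Qed.

Lemma lambda_neq0 : l != 0.
Proof.
by apply: contra_eq_neq lambda4 => ->; rewrite expr0n eq_sym oppr_eq0 oner_eq0.
Qed.

Lemma lambdaJ : l^*%C = l^-1.
Proof.
by apply: (mulfI lambda_neq0); rewrite lambda_conj divff ?lambda_neq0.
Qed.

Lemma u_neq0 : u != 0.
Proof. by rewrite eq_complex /= add0r oner_eq0 andbF. Qed.

Lemma w_neq0 : w != 0.
Proof. by rewrite eq_complex /= add0r oppr_eq0 oner_eq0 andbF. Qed.

Lemma nuE : v = u / (l ^+ 3 * w).
Proof. by rewrite /nu mulrCA -invfM. Qed.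

Lemma nu_neq0 : v != 0.
Proof.
by rewrite nuE mulf_neq0 ?invr_eq0 ?u_neq0 // mulf_neq0 ?w_neq0 // expf_neq0 ?lambda_neq0.
Qed.

Lemma nuVE : v^-1 = l ^+ 3 * w / u.
Proof. by rewrite nuE invf_div. Qed.

Lemma nuJ : v^*%C = v^-1.
Proof.
rewrite nuVE nuE conjcM conjc_inv conjcM conjcX lambdaJ.
have -> : u^*%C = w by apply/eqP; rewrite eq_complex /= !(addr0, add0r, oppr0) !eqxx.
have -> : w^*%C = u.
  by apply/eqP; rewrite eq_complex /= !(addr0, add0r, oppr0, opprK) !eqxx.
by rewrite exprVn invfM invrK mulrCA mulrA.
Qed.

Lemma u2w2 : u ^+ 2 + w ^+ 2 != 0.
Proof.
have -> : u ^+ 2 + w ^+ 2 = 2 * ((alpha beta)%:C ^+ 2 + 'i%C ^+ 2) by ring.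
rewrite mulf_neq0 ?pnatr_eq0 // sqr_i subr_eq0 -rmorphXn -(rmorph1 (real_complex R)).
apply/eqP => /complexI/eqP; rewrite sqrp_eq1 ?expR_ge0 // => /eqP.
by rewrite /alpha -[RHS]expR0 => /expR_inj/eqP; rewrite mulNr oppr_eq0 mulf_eq0 pnatr_eq0 /= (gt_eqF beta_gt0).
Qed.

Lemma u_neqw : u != w.
Proof.
rewrite eq_complex /= !add0r oppr0 eqxx /=.
by rewrite -subr_eq0 opprK -mulr2n pnatr_eq0.
Qed.

Lemma u_neqNw : u != - w.
Proof.
rewrite eq_complex /= !(addr0, oppr0) -subr_eq0 opprK -mulr2n mulrn_eq0 /=.
by rewrite expR_eq0.
Qed.

Lemma nondeg_interior : v * l ^- 3 != v^-1 * l ^+ 3.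
Proof.
rewrite nuVE nuE -subr_eq0.
have -> : u / (l ^+ 3 * w) / l ^+ 3 - l ^+ 3 * w / u * l ^+ 3
    = (u ^+ 2 - (l ^+ 4) ^+ 3 * w ^+ 2) / (l ^+ 6 * w * u).
  by field; rewrite lambda_neq0 u_neq0 w_neq0.
rewrite lambda4 -[_ ^+ 3]signr_odd expr1 mulN1r opprK.
by rewrite mulf_neq0 ?u2w2 // invr_eq0 !mulf_neq0 ?expf_neq0 ?lambda_neq0 ?u_neq0 ?w_neq0.
Qed.

Lemma nu_neqNlambda : v != - l.
Proof.
rewrite nuE -subr_eq0 opprK.
have -> : u / (l ^+ 3 * w) + l = (u + l ^+ 4 * w) / (l ^+ 3 * w).
  by field; rewrite lambda_neq0 w_neq0.
rewrite lambda4 mulN1r mulf_neq0 ?subr_eq0 ?u_neqw //.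
by rewrite invr_eq0 mulf_neq0 ?expf_neq0 ?lambda_neq0 ?w_neq0.
Qed.

Lemma nondeg_top : v * l^-1 != v^-1 * l.
Proof.
rewrite nuVE nuE -subr_eq0.
have -> : u / (l ^+ 3 * w) / l - l ^+ 3 * w / u * l
    = (u ^+ 2 - (l ^+ 4) ^+ 2 * w ^+ 2) / (l ^+ 3 * l * w * u).
  by field; rewrite lambda_neq0 u_neq0 w_neq0.
rewrite lambda4 sqrrN expr1n mul1r subr_sqr.
have uw1 : u - w != 0 by rewrite subr_eq0 u_neqw.
have uw2 : u + w != 0 by rewrite -[X in _ + X]opprK subr_eq0 u_neqNw.
apply: mulf_neq0; first exact: mulf_neq0.
by rewrite invr_eq0 !mulf_neq0 ?expf_neq0 ?lambda_neq0 ?u_neq0 ?w_neq0.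
Qed.

End SHolomorphicTheory.

Section PropagatorTheory.
Variables (R : realType) (a b : int) (beta : R).
Hypotheses (ab : a < b) (beta_gt0 : 0 < beta).

Local Notation m := (`|b - a|%N).
Local Notation row := {ffun 'I_m * 'I_2 -> R^o}.
Local Notation l := (lambda R).
Local Notation v := (nu beta).

Local Notation north_eqs n e w :=
  (n + v^-1 * l * n^*%C = v^-1 * e + l * e^*%C /\
   n + v * l^-1 * n^*%C = v * w + l^-1 * w^*%C).
Local Notation east_eq s e :=
  (s + v * l ^+ 3 * s^*%C = v * e + l ^+ 3 * e^*%C).
Local Notation west_eq s w :=
  (s + v^-1 * l ^- 3 * s^*%C = v^-1 * w + l ^- 3 * w^*%C).

Let l1 : l * l^*%C = 1 := lambda_conj R.
Let l0 := lambda_neq0 R.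
Let v0 := nu_neq0 beta.
Let v1 : v * v^*%C = 1. Proof. by rewrite nuJ divff. Qed.

Let unitX (x : R[i]) n : x * x^*%C = 1 -> x ^+ n * (x ^+ n)^*%C = 1.
Proof. by move=> x1; rewrite conjcX -exprMn x1 expr1n. Qed.

Let unitV (x : R[i]) : x * x^*%C = 1 -> x^-1 * x^-1^*%C = 1.
Proof. by move=> x1; rewrite conjc_inv -invfM x1 invr1. Qed.

Let unitM (x y : R[i]) :
  x * x^*%C = 1 -> y * y^*%C = 1 -> x * y * (x * y)^*%C = 1.
Proof. by move=> x1 y1; rewrite conjcM mulrACA x1 y1 mulr1. Qed.

Let unitN (x : R[i]) : x * x^*%C = 1 -> - x * (- x)^*%C = 1.
Proof. by move=> x1; rewrite (rmorphN (@conjc R)) mulrNN. Qed.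

Let lJ : l^*%C = l^-1 := lambdaJ R.
Let vJ : v^*%C = v^-1 := nuJ beta.
Let cD (x y : R[i]) : (x + y)^*%C = x^*%C + y^*%C := rmorphD (@conjc R) x y.
Let cE := (cD, @conjcM R, @conjc_inv R, @conjcX R, lJ, vJ, @conjcK R, @invrK R[i]).

Let compat (c d s : R[i]) : c * c^*%C = 1 -> d * d^*%C = 1 ->
  s + c * d * s^*%C = c * d * (s + c * d * s^*%C)^*%C.
Proof.
move=> c1 d1; rewrite !(cD, @conjcM R, @conjcK R) mulrDr addrC; congr (_ + _).
by rewrite mulrA mulrACA c1 d1 !mul1r.
Qed.

Let compat' (c d c' d' s : R[i]) :
    c * c^*%C = 1 -> d * d^*%C = 1 -> c' * c'^*%C = 1 -> d' * d'^*%C = 1 ->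
  c * d = c' * d' ->
  c * s + d * s^*%C = c' * d' * (c * s + d * s^*%C)^*%C.
Proof.
move=> c1 d1 _ _ <-; rewrite !(cD, @conjcM R, @conjcK R) mulrDr addrC.
congr (_ + _).
  by rewrite mulrA (mulrC c d) -(mulrA d c) c1 mulr1.
by rewrite mulrA -(mulrA c d) d1 mulr1.
Qed.

Let north_uniq e w : exists n, north_eqs n e w /\
  forall n', north_eqs n' e w -> n' = n.
Proof.
have one1 : (1 : R[i]) * 1^*%C = 1 by rewrite conjc1 mulr1.
have vl1 := unitM (unitV v1) l1; have vl2 := unitM v1 (unitV l1).
have ne : 1 * (v * l^-1) != 1 * (v^-1 * l) by rewrite !mul1r nondeg_top.
have [||n [h1 h2 U]] := @two_lines R 1 (v^-1 * l) (v^-1 * e + l * e^*%C)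
  1 (v * l^-1) (v * w + l^-1 * w^*%C) one1 vl1 one1 vl2 _ _ ne.
- by rewrite mul1r; apply: compat' => //; apply: unitV.
- by rewrite mul1r; apply: compat' => //; apply: unitV.
rewrite !mul1r in h1 h2; exists n; split=> [|n' [h1' h2']]; first by split.
by apply: U; rewrite mul1r.
Qed.

Let line_left z :
  (exists t : R, z = t%:C * l^-1) <-> l * z + - l^-1 * z^*%C = 0.
Proof.
split=> [[t ->]|/eqP].
  by rewrite !cE conjc_real; field.
rewrite mulNr subr_eq0 => /eqP h.
have /complex_realP[t tE] : l * z \is Num.real.
  have : (l * z)^*%C = l * z by rewrite !cE h.
  case: (l * z) => x y [] /eqP; rewrite -subr_eq0 -opprD oppr_eq0 -mulr2n.
  by rewrite mulrn_eq0 /= => /eqP ->; apply/complex_realP; exists x.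
by exists t; rewrite -tE mulrC mulKf.
Qed.

Let line_right z :
  (exists t : R, z = t%:C * l) <-> l^-1 * z + - l * z^*%C = 0.
Proof.
split=> [[t ->]|/eqP].
  by rewrite !cE conjc_real; field.
rewrite mulNr subr_eq0 => /eqP h.
have /complex_realP[t tE] : l^-1 * z \is Num.real.
  have : (l^-1 * z)^*%C = l^-1 * z by rewrite !cE h.
  case: (l^-1 * z) => x y [] /eqP; rewrite -subr_eq0 -opprD oppr_eq0 -mulr2n.
  by rewrite mulrn_eq0 /= => /eqP ->; apply/complex_realP; exists x.
by exists t; rewrite -tE mulrC mulVKf.
Qed.

Let m_gt0 : (0 < m)%N.
Proof. by rewrite absz_gt0 subr_eq0 gt_eqF. Qed.

Local Notation vertical_eqs s n z :=
  [/\ (0 < n)%N -> east_eq (s n.-1) z, (n < m)%N -> west_eq (s n) z,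
      n = 0%N -> l * z + - l^-1 * z^*%C = 0
    & n = m -> l^-1 * z + - l * z^*%C = 0].

Let vertical_uniq (s : nat -> R[i]) n : exists z,
  (n <= m)%N -> vertical_eqs s n z /\
    forall z', vertical_eqs s n z' -> z' = z.
Proof.
have [nm|nm] := leqP n m; last by exists 0.
have l31 := unitX 3 l1; have lV1 := unitV l1; have vV1 := unitV v1.
have l3V1 := unitV l31.
have zero (x : R[i]) : 0 = x * 0^*%C by rewrite conjc0 mulr0.
have [n0|n_gt0] := posnP n.
  have [|z [h1 h2 U]] := @two_lines R l (- l^-1) 0 v^-1 (l ^- 3)
    (s n + v^-1 * l ^- 3 * (s n)^*%C) l1 (unitN lV1) vV1 l3V1 (zero _)
    (compat _ vV1 l3V1).
    rewrite mulrN -subr_eq0 opprK.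
    have -> : l * l ^- 3 + v^-1 * l^-1 = (v - - l) / (l ^+ 2 * v).
      by field; rewrite l0 v0.
    by rewrite mulf_neq0 ?subr_eq0 ?nu_neqNlambda // invr_eq0 mulf_neq0 ?expf_neq0.
  exists z => _; split.
    by split=> // H; first [by move: H; rewrite n0 | by move: m_gt0; rewrite -H n0].
  move=> z' [_ h2' h1' _]; apply: U; first exact: h1'.
  by rewrite -h2' ?n0.
have [nE|n_ltm] := eqVneq n m.
  have [|z [h1 h2 U]] := @two_lines R v (l ^+ 3)
    (s n.-1 + v * l ^+ 3 * (s n.-1)^*%C) l^-1 (- l) 0
    v1 l31 lV1 (unitN l1) (compat _ v1 l31) (zero _).
    rewrite mulrN -subr_eq0.
    have -> : - (v * l) - l^-1 * l ^+ 3 = - (v - - l) * l by field.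
    by rewrite mulf_neq0 // oppr_eq0 subr_eq0 nu_neqNlambda.
  exists z => _; split.
    by split=> // H; first [by move: H; rewrite nE ltnn | by move: n_gt0; rewrite H].
  move=> z' [h1' _ _ h2']; apply: U; last exact: h2'.
  by rewrite -h1'.
have [|z [h1 h2 U]] := @two_lines R v (l ^+ 3)
  (s n.-1 + v * l ^+ 3 * (s n.-1)^*%C) v^-1 (l ^- 3)
  (s n + v^-1 * l ^- 3 * (s n)^*%C) v1 l31 vV1 l3V1
  (compat _ v1 l31) (compat _ vV1 l3V1).
  exact: nondeg_interior.
exists z => _; split.
  by split=> // H; first [by move: n_gt0; rewrite H | by move: n_ltm; rewrite H eqxx].
move=> z' [h1' h2' _ _]; apply: U; first by rewrite -h1'.
by rewrite -h2' // ltn_neqAle n_ltm.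
Qed.

Let faceE h n : ms_holo beta h (dual_site R a n +i* 2^-1) <->
  [/\ north_eqs (h (dual_site R a n +i* 1)) (h (site R a n.+1 +i* 2^-1))
        (h (site R a n +i* 2^-1)),
      east_eq (h (dual_site R a n +i* 0)) (h (site R a n.+1 +i* 2^-1))
    & west_eq (h (dual_site R a n +i* 0)) (h (site R a n +i* 2^-1))].
Proof.
have half : (2^-1 : R[i]) = 2^-1 +i* 0.
  by rewrite complexr0 fmorphV rmorph_nat.
have d2 : 2^-1 + 2^-1 = 1 :> R by field.
have ihalf : 'i%C / 2 = 0 +i* 2^-1 :> R[i] by rewrite half; simpc.
have dD : dual_site R a n + 2^-1 = site R a n.+1.
  by rewrite /dual_site /site -[n.+1]addn1 natrD -addrA d2 addrA.
have dB : dual_site R a n - 2^-1 = site R a n by rewrite /dual_site addrK.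
set c := dual_site R a n +i* 2^-1.
have cE_ : c + 2^-1 = site R a n.+1 +i* 2^-1 by rewrite half /c; simpc; rewrite dD.
have cN : c + 'i%C / 2 = dual_site R a n +i* 1.
  by rewrite ihalf /c; simpc; rewrite d2.
have cW : c - 2^-1 = site R a n +i* 2^-1 by rewrite half /c; simpc; rewrite dB.
have cS : c - 'i%C / 2 = dual_site R a n +i* 0.
  by rewrite ihalf /c; simpc; rewrite ?subrr.
by rewrite /ms_holo cE_ cN cW cS; split=> [[? ? ? ?]|[[? ?] ? ?]].
Qed.

Let bE : b%:~R = site R a m.
Proof.
by rewrite /site pmulrn -intrD gez0_abs ?subr_ge0 ?ltW //; congr (_ *~ _); ring.
Qed.

Let aE : a%:~R = site R a 0. Proof. by rewrite /site addr0. Qed.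

Let extensionE f h : is_extension beta f h <->
  [/\ forall k : 'I_m, h (dual_site R a k +i* 0) = cvalue f k,
      forall k : 'I_m, north_eqs (h (dual_site R a k +i* 1))
        (h (site R a k.+1 +i* 2^-1)) (h (site R a k +i* 2^-1))
    & forall n, (n <= m)%N ->
        vertical_eqs (fun k => h (dual_site R a k +i* 0)) n
          (h (site R a n +i* 2^-1))].
Proof.
rewrite /is_extension aE bE; split=> [[hf hc hl hr]|[hf hn hv]].
  split=> // [k|n nm]; first by have /faceE[] := hc k.
  split=> [n0|ltnm|->|->]; [|by have /faceE[] := hc (Ordinal ltnm)
    |exact/line_left|exact/line_right].
  case: n nm n0 => // n nm _.
  by have /faceE[] := hc (Ordinal nm).
split=> // [k||].
- apply/faceE; split; first exact: hn.
    by have [/(_ isT)] := hv k.+1 (ltn_ord k).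
  by have [_ /(_ (ltn_ord k))] := hv k (ltnW (ltn_ord k)).
- by apply/line_left; have [_ _ ->] := hv 0%N isT.
- by apply/line_right; have [_ _ _ ->] := hv m (leqnn m).
Qed.

Lemma extension_exists_unique (f : row) : exists2 h, is_extension beta f h &
  forall h', is_extension beta f h' ->
    (forall n, (n <= m)%N ->
       h' (site R a n +i* 2^-1) = h (site R a n +i* 2^-1)) /\
    (forall k : 'I_m, h' (dual_site R a k +i* 1) = h (dual_site R a k +i* 1)).
Proof.
pose s n := if insub n is Some k then cvalue f k else 0.
have sE (k : 'I_m) : s k = cvalue f k by rewrite /s valK.
have [z zP] := choice (vertical_uniq s).
have [t tP] := choice (fun n => north_uniq (z n.+1) (z n)).
pose lookup (pos : nat -> R) (val : nat -> R[i]) x :=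
  val (xget 0%N [set n | pos n = x]).
have lookupE pos val n : injective pos -> lookup pos val (pos n) = val n.
  move=> inj; congr (val _); apply: xget_unique => //= k; exact: inj.
have site_inj : injective (site R a) by move=> i j /addrI/eqP; rewrite eqr_nat => /eqP.
have dual_inj : injective (dual_site R a) by move=> i j /addIr; exact: site_inj.
pose h (p : R[i]) : R[i] := let: x +i* y := p in
  if y == 0 then lookup (dual_site R a) s x
  else if y == 1 then lookup (dual_site R a) t x
  else lookup (site R a) z x.
have h0 n : h (dual_site R a n +i* 0) = s n by rewrite /h eqxx lookupE.
have h1 n : h (dual_site R a n +i* 1) = t n.
  by rewrite /h oner_eq0 eqxx lookupE.
have h2 n : h (site R a n +i* 2^-1) = z n.
  by rewrite /h invr_eq0 pnatr_eq0 /= invr_eq1 pnatr_eq1 /= lookupE.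
clearbody h.
exists h => [|h' /extensionE[hf hn hv]].
  apply/extensionE; split=> [k|k|n nm]; rewrite ?(h0, h1, h2, sE) //.
    by case: (tP k).
  by case: (zP n nm).
have hz n : (n <= m)%N -> h' (site R a n +i* 2^-1) = h (site R a n +i* 2^-1).
  move=> nm; rewrite h2; apply: (zP n nm).2; have [e1 e2 e3 e4] := hv n nm.
  split=> // [n0|ltnm].
    have ltnm : (n.-1 < m)%N by rewrite prednK.
    by rewrite (sE (Ordinal ltnm)) -hf; apply: e1.
  by rewrite (sE (Ordinal ltnm)) -hf; apply: e2.
split=> // k; rewrite h1; apply: (tP k).2.
by rewrite -!h2 -!hz ?(ltnW (ltn_ord k)) //; apply: hn.
Qed.

Let cvalue_inj : injective (@cvalue R a b).
Proof.
move=> f g fg; apply/ffunP=> -[k i].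
have := congr1 (fun F => F k) fg; rewrite /cvalue => -[e0 e1].
case: i => -[|[|//]] p.
  by have -> : Ordinal p = ord0 by exact: val_inj.
by have -> : Ordinal p = ord_max by exact: val_inj.
Qed.

Lemma propagation_exists (f : row) : exists g, is_propagation beta f g.
Proof.
have [h hf _] := extension_exists_unique f.
exists [ffun j : 'I_m * 'I_2 => let y := h (dual_site R a j.1 +i* 1) in
  if j.2 == ord0 then complex.Re y else complex.Im y].
by exists h => // k; rewrite /cvalue !ffunE /=; case: (h _).
Qed.

Lemma propagation_unique (f g g' : row) :
  is_propagation beta f g -> is_propagation beta f g' -> g = g'.
Proof.
have [h _ U] := extension_exists_unique f.
move=> [h1 /U[_ e1] hg] [h2 /U[_ e2] hg'].
by apply: cvalue_inj; apply/funext => k; rewrite -hg -hg' e1 e2.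
Qed.

Lemma propagatorP (f : row) : is_propagation beta f (propagator beta f).
Proof.
rewrite /propagator; have [g gP] := propagation_exists f.
by case: xgetP => // /(_ g).
Qed.

Lemma propagator_linear : linear (@propagator R a b beta).
Proof.
move=> c f g; apply: propagation_unique (propagatorP _) _.
have [h hf hP] := propagatorP f; have [h' hg h'P] := propagatorP g.
have cvalueD (f1 f2 : row) k :
    cvalue (c *: f1 + f2) k = c%:C * cvalue f1 k + cvalue f2 k.
  by rewrite /cvalue !ffunE; simpc.
exists (fun p => c%:C * h p + h' p) => [|k]; last by rewrite cvalueD hP h'P.
case: hf => [f1 f2 [t1 f3] [t2 f4]]; case: hg => [g1 g2 [t1' g3] [t2' g4]].
have lin (x y : R[i]) : (c%:C * x + y)^*%C = c%:C * x^*%C + y^*%C.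
  by rewrite cD conjcM conjc_real.
split=> [k|k||].
- by rewrite cvalueD f1 g1.
- have [e1 e2 e3 e4] := f2 k; have [e1' e2' e3' e4'] := g2 k.
  have comb (p x x1 y y1 p' q' : R[i]) :
      x + p * x^*%C = p' * y + q' * y^*%C ->
      x1 + p * x1^*%C = p' * y1 + q' * y1^*%C ->
      (c%:C * x + x1) + p * (c%:C * x + x1)^*%C
      = p' * (c%:C * y + y1) + q' * (c%:C * y + y1)^*%C.
    move=> E1 E2; rewrite !lin.
    transitivity (c%:C * (x + p * x^*%C) + (x1 + p * x1^*%C)); first by ring.
    by rewrite E1 E2; ring.
  by split; apply: comb.
- by exists (c * t1 + t1'); rewrite f3 g3 rmorphD rmorphM mulrDl mulrA.
- by exists (c * t2 + t2'); rewrite f4 g4 rmorphD rmorphM mulrDl mulrA.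
Qed.

End PropagatorTheory.

Section ComplexificationTheory.
Variables (R : realType) (J : finType).
Implicit Types P : {ffun J -> R^o} -> {ffun J -> R^o}.

Lemma complexifyE P (w : {ffun J -> R[i]^o}) j : linear P ->
  complexify P w j
  = P [ffun j' => complex.Re (w j')] j +i* P [ffun j' => complex.Im (w j')] j.
Proof.
move=> linP; rewrite linfunE ?ffunE // => c x y; apply/ffunP=> k.
have PD c1 c2 (f g : {ffun J -> R^o}) : P (c1 *: f + (c2 *: g)) k = c1 * P f k + c2 * P g k.
  have -> : c2 *: g = c2 *: g + 0 by rewrite addr0.
  have P0 : P 0 = 0 by have := linP (-1) 0 0; rewrite scaler0 addr0 scaleN1r addNr.
  by rewrite !linP P0 addr0 !ffunE.
rewrite !ffunE.
pose xR : {ffun J -> R^o} := [ffun j' => complex.Re (x j')].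
pose xI : {ffun J -> R^o} := [ffun j' => complex.Im (x j')].
pose yR : {ffun J -> R^o} := [ffun j' => complex.Re (y j')]; pose yI : {ffun J -> R^o} := [ffun j' => complex.Im (y j')].
have -> : [ffun j' => complex.Re ((c *: x + y) j')]
    = complex.Re c *: xR + (1 *: (- complex.Im c *: xI + 1 *: yR)) :> {ffun J -> R^o}.
  apply/ffunP=> j'; rewrite !ffunE !scale1r.
  by case: c (x j') (y j') => [? ?] [? ?] [? ?]; rewrite /= /GRing.scale /= mulNr addrA.
have -> : [ffun j' => complex.Im ((c *: x + y) j')]
    = complex.Re c *: xI + (1 *: (complex.Im c *: xR + 1 *: yI)) :> {ffun J -> R^o}.
  apply/ffunP=> j'; rewrite !ffunE !scale1r.
  by case: c (x j') (y j') => [? ?] [? ?] [? ?]; rewrite /= /GRing.scale /= addrA.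
rewrite !PD !mul1r; case: c => c1 c2 /=; rewrite /GRing.scale /=; simpc.
by congr (_ +i* _); rewrite /xR /xI /yR /yI; ring.
Qed.

End ComplexificationTheory.

Lemma Wcirc_stable (R : realType) (a b : int) (beta : R) :
  (propagatorC a b beta @: Wcirc a b beta <= Wcirc a b beta)%VS.
Proof.
set A := [set w | w != 0 /\
  exists2 mu : R, mu < 1 & propagatorC a b beta w = mu%:C *: w].
have [inW minW] := vspanP A; have -> : Wcirc a b beta = vspan A by [].
suff /limgS/subv_trans : (vspan A <= propagatorC a b beta @^-1: vspan A)%VS.
  by apply; apply/subvP => _ /memv_imgP[x xW ->]; rewrite memv_preim.
apply: minW => w wA; rewrite -memv_preim.
by have [_ [mu _ ->]] := wA; rewrite memvZ // inW.
Qed.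

(* Main.v *)
Require Import Defs.
From HB Require Import structures.
From mathcomp Require Import all_boot all_order all_fingroup all_algebra.
From mathcomp Require Import sesquilinear spectral.
From mathcomp Require Import complex ring lra.
From mathcomp Require Import boolp reals sequences exp.

(** Attach to f in (C^2)^{I^*} the operator psi(f) = sum_k f(k,0) (p_k - q_k)
    + f(k,1) (p_k + q_k), where p_k and q_k flip all spins to the left of the
    dual site k and multiply by the spin on the right, resp. left, of k. These
    satisfy Clifford relations for the bilinear form
    B(f,g) = sum_k f(k,0) g(k,1) + f(k,1) g(k,0), and V psi(f) = psi(P f) V.
    In the coordinates (u, v) on a vertical edge for which the value of h is
    lambda (u - i v), massive s-holomorphicity becomes a real 2x2 system with
    coefficients 1 and +-alpha; it shows that P is Hermitian and positive, is
    B-orthogonal and has no eigenvalue 1. Hence an orthonormal eigenbasis (w_i)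
    of W_circ has a B-dual family (w'_i) of eigenvectors with inverse
    eigenvalues. A top eigenvector of V on S_+ is killed by every psi(w'_i),
    since psi(w'_i) would raise its eigenvalue; applying the psi(w_i) to it
    produces an eigenbasis of S_+ indexed by the sets of indices, which rho
    sends to the corresponding wedge products. *)

Set Implicit Arguments.
Unset Strict Implicit.
Unset Printing Implicit Defensive.

Import Order.TTheory GRing.Theory Num.Theory.

Local Open Scope ring_scope.
Local Open Scope complex_scope.

(** * Hermitian operators *)

Section HermitianOperators.
Variables (R : rcfType) (I : finType).
Local Notation X := {ffun I -> R[i]^o}.

Definition hdot (x y : X) : R[i] := \sum_i x i * (y i)^*%C.

Lemma hdot_basis (x : X) j : hdot x (basis_vec R[i] j) = x j.
Proof.
rewrite /hdot (bigD1 j) //= ffunE eqxx conjc1 mulr1 big1 ?addr0 // => i ij.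
by rewrite ffunE (negPf ij) conjc0 mulr0.
Qed.

Lemma hdotC x y : hdot x y = (hdot y x)^*%C.
Proof.
rewrite /hdot rmorph_sum; apply: eq_bigr => i _.
by rewrite /= conjcM conjcK mulrC.
Qed.

Lemma hdotZl c x y : hdot (c *: x) y = c * hdot x y.
Proof. by rewrite /hdot mulr_sumr; apply: eq_bigr => i _; rewrite ffunE -mulrA. Qed.

Lemma hdotZr c x y : hdot x (c *: y) = c^*%C * hdot x y.
Proof. by rewrite hdotC hdotZl conjcM -hdotC. Qed.

Lemma hdot1_neq0 x : hdot x x = 1 -> x != 0.
Proof.
move=> x1; apply/eqP => x0; move: x1 => /eqP; rewrite x0 /hdot big1 => [|i _].
  by rewrite eq_sym oner_eq0.
by rewrite ffunE mul0r.
Qed.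

(** The spectral theorem for matrices, carried to functions on [I] by [enum_val]. The matrix [A]
    acts on row vectors from the right, so the eigenvectors are the rows of the unitary
    [spectralmx A]. *)
Lemma hermitian_eigenbasis (f : 'End(X)) :
    (forall x y, hdot (f x) y = hdot x (f y)) ->
  exists (v : 'I_#|I| -> X) (d : 'I_#|I| -> R),
    [/\ forall j, f (v j) = (d j)%:C *: v j,
        forall j k, hdot (v j) (v k) = (j == k)%:R
      & forall x, x = \sum_j hdot x (v j) *: v j].
Proof.
move=> fH; pose e := fun i : 'I_#|I| => basis_vec R[i] (enum_val i).
pose A : 'M[R[i]]_#|I| := \matrix_(i, j) f (e i) (enum_val j).
have AH : A \is hermsymmx.
  rewrite qualifE /= expr0 scale1r; apply/eqP/matrixP => i j; rewrite !mxE.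
  by rewrite -[RHS](conjcK) -(hdot_basis (f (e i)) (enum_val j)) fH hdotC hdot_basis conjcK.
pose U := spectralmx A; have U1 := spectral_unitarymx A.
have conjE (z : R[i]) : Num.conj z = z^*%C by [].
pose toX (u : 'rV[R[i]]_#|I|) : X := [ffun i => u 0 (enum_rank i)].
have ftoX u : f (toX u) = toX (u *m A).
  rewrite [toX u]basis_vec_sum linear_sum; apply/ffunP => i; rewrite sum_ffunE ffunE mxE.
  rewrite (reindex (enum_val : 'I_#|I| -> I)) /=; last exact/onW_bij/enum_val_bij.
  by apply: eq_bigr => j _; rewrite linearZ !ffunE mxE enum_valK enum_rankK.
have [D AE] : {D | A = invmx U *m diag_mx D *m U /\ D = spectral_diag A}.
  by exists (spectral_diag A); split=> //; apply/orthomx_spectralP/hermitian_normalmx.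
case: AE => AE DE.
have DR j : D 0 j = (complex.Re (D 0 j))%:C.
  have /mxOverP/(_ 0 j) := hermitian_spectral_diag_real AH.
  by rewrite -DE => /complex_realP[r ->].
have UA j : row j U *m A = D 0 j *: row j U.
  rewrite AE -row_mul 2!mulmxA mulmxV ?unitarymx_unit // mul1mx.
  by apply/rowP => k; rewrite mxE mul_diag_mx !mxE.
have UU : U *m U^t*%sesqui = 1%:M by apply/eqP; move: U1; rewrite qualifE.
have UU' : U^t*%sesqui *m U = 1%:M by rewrite -invmx_unitary // mulVmx ?unitarymx_unit.
exists (fun j => toX (row j U)), (fun j => complex.Re (D 0 j)); split=> [j|j k|x].
- by rewrite -DR ftoX UA; apply/ffunP => i; rewrite !ffunE mxE.
- have /matrixP/(_ j k) := UU; rewrite !mxE => <-.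
  rewrite /hdot (reindex (enum_val : 'I_#|I| -> I)) /=; last exact/onW_bij/enum_val_bij.
  by apply: eq_bigr => i _; rewrite !ffunE !mxE enum_valK.
apply/ffunP => i; rewrite sum_ffunE.
pose u : 'rV[R[i]]_#|I| := \row_j x (enum_val j).
have -> : x i = (u *m (U^t*%sesqui *m U)) 0 (enum_rank i).
  by rewrite UU' mulmx1 mxE enum_rankK.
rewrite mulmxA mxE; apply: eq_bigr => j _; rewrite !ffunE !mxE; congr (_ * _).
rewrite /hdot (reindex (enum_val : 'I_#|I| -> I)) /=; last exact/onW_bij/enum_val_bij.
by apply: eq_bigr => k _; rewrite !ffunE !mxE enum_valK.
Qed.

End HermitianOperators.

(** In an orthonormal eigenbasis a diagonal entry is a combination of the eigenvalues with
    nonnegative weights, so a positive entry forces a positive eigenvalue. Every eigenvalue is some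
    [d k], as its eigenvector is not orthogonal to all the [v k]. *)
Lemma hermitian_top_eigenvector (R : rcfType) (I : finType)
    (f : 'End({ffun I -> R[i]^o})) (i : I) :
    (forall x y, hdot (f x) y = hdot x (f y)) ->
    0 < f (basis_vec R[i] i) i ->
  exists u (L : R), [/\ u != 0, 0 < L, f u = L%:C *: u
    & forall x (c : R), x != 0 -> f x = c%:C *: x -> c <= L].
Proof.
move=> fH fi; have [v [d [fv vv vx]]] := hermitian_eigenbasis fH.
have [j0 dj0] : exists j, 0 < d j.
  apply/existsP; apply: contraLR fi; rewrite negb_exists => /forallP d_le0.
  have fE : f (basis_vec R[i] i) i = \sum_j (d j)%:C * (v j i * (v j i)^*%C).
    rewrite {1}(vx (basis_vec R[i] i)) linear_sum sum_ffunE; apply: eq_bigr => j _.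
    by rewrite linearZ /= fv !ffunE hdotC hdot_basis /GRing.scale /=; ring.
  rewrite fE; apply/negP => /lt_geF/negP; apply.
  apply: sumr_le0 => j _; rewrite mulr_le0_ge0 ?mulcJ_ge0 //.
  by rewrite lecR leNgt d_le0.
have v0 j : v j != 0 by apply: hdot1_neq0; rewrite vv eqxx.
case: (@Order.TotalTheory.arg_maxP _ _ _ j0 xpredT d) => // j _ dj.
exists (v j), (d j); split=> // [|x c x0 fx].
  by apply: lt_le_trans dj0 _; apply: dj.
have [k xk] : exists k, hdot x (v k) != 0.
  apply/existsP; apply: contraNT x0; rewrite negb_exists => /forallP xk.
  apply/eqP; rewrite (vx x) big1 // => k _.
  by move: (xk k); rewrite negbK => /eqP ->; rewrite scale0r.
suff -> : c = d k by apply: dj.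
apply/complexI/(mulIf xk); rewrite -hdotZl -fx fH fv hdotZr.
by rewrite (conjc_real (d k)).
Qed.

Lemma hdot_suml (R : rcfType) (I J : finType) (c : J -> R[i]) (f : J -> {ffun I -> R[i]^o}) y :
  hdot (\sum_j c j *: f j) y = \sum_j c j * hdot (f j) y.
Proof.
rewrite /hdot; under eq_bigr do rewrite sum_ffunE mulr_suml.
rewrite exchange_big; apply: eq_bigr => j _; rewrite mulr_sumr.
by apply: eq_bigr => i _; rewrite ffunE -mulrA.
Qed.

(** Orthonormal vectors are free. Serves to compare the numbers of eigenvalues below and above
    one. *)
Lemma orthonormal_card (R : rcfType) (I J : finType) (A B : {set J})
    (h v : J -> {ffun I -> R[i]^o}) :
    {in A &, forall j k, hdot (h j) (h k) = (j == k)%:R} ->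
    {in A, forall j, h j \in \sum_(k in B) <[v k]>}%VS ->
  (#|A| <= #|B|)%N.
Proof.
move=> hh hB; pose X := [tuple h (enum_val i) | i < #|A|].
have Xi (i : 'I_#|A|) : X`_i = h (enum_val i) by rewrite -tnth_nth tnth_mktuple.
have /eqnP : free X.
  apply/freeP => k k0 i; have := congr1 (fun x => hdot x (h (enum_val i))) k0.
  rewrite hdot_suml (bigD1 i) //= Xi hh ?enum_valP // eqxx mulr1 big1 => [|j ji].
    by rewrite addr0 => ->; rewrite /hdot big1 // => ? _; rewrite ffunE mul0r.
  by rewrite Xi hh ?enum_valP // (inj_eq enum_val_inj) (negPf ji) mulr0.
rewrite size_tuple => <-.
have XB : (<<X>> <= \sum_(k in B) <[v k]>)%VS.
  apply/span_subvP => x /tnthP[i ->].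
  by rewrite tnth_mktuple hB ?enum_valP.
apply: (leq_trans (dimvS XB)); apply: (leq_trans (dimv_leq_sum _ _ _)); rewrite -sum1_card.
by apply: leq_sum => k _; rewrite dim_vline; case: (_ != 0).
Qed.


(** * Exterior powers and Fock vectors *)

Section FockVectors.
Variables (K : fieldType) (U : vectType K) (m : nat).
Variables (c c' : 'I_m -> 'End(U)) (vac : U).
Hypothesis cc : forall i j x, c i (c j x) + c j (c i x) = 0.
Hypothesis cc' : forall i j x, c i (c' j x) + c' j (c i x) = (i == j)%:R *: x.
Hypothesis c'vac : forall i, c' i vac = 0.
Hypothesis vac0 : vac != 0.

(** The [c i] act as creation operators, the [c' i] as annihilation operators, and [vac] is the
    vacuum. Exchanging two letters changes the sign, so [fock] fixes the order of [enum], as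
    [ext_vec] does. *)
Definition fock_word (s : seq 'I_m) : U := foldr (fun i x => c i x) vac s.

Definition fock (A : {set 'I_m}) : U := fock_word (enum A).

Let c'c i j x : c' j (c i x) = (i == j)%:R *: x - c i (c' j x).
Proof. by rewrite -(cc' i j) [X in X - _]addrC addrK. Qed.

Lemma annihilate_notin i s : i \notin s -> c' i (fock_word s) = 0.
Proof.
elim: s => [_|j s IH]; first exact: c'vac.
rewrite inE negb_or => /andP[ij si] /=.
by rewrite c'c eq_sym (negPf ij) scale0r IH // linear0 subr0.
Qed.

Lemma number_fock_word i s : uniq s ->
  c i (c' i (fock_word s)) = (i \in s)%:R *: fock_word s.
Proof.
elim: s => [_|j s IH] /=; first by rewrite c'vac linear0 scale0r.
move=> /andP[js us]; rewrite c'c inE; have [ij|ij] := eqVneq i j.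
  rewrite -ij in js *; rewrite annihilate_notin // linear0 subr0 /=.
  by rewrite !scale1r.
rewrite scale0r sub0r linearN /= -linearZ -IH //.
by apply/eqP; rewrite eq_sym -subr_eq0 opprK addrC cc.
Qed.

(** On a word without the letter [i], [c' i] undoes [c i], so adding a new letter cannot give
    zero. *)
Lemma fock_word_neq0 s : uniq s -> fock_word s != 0.
Proof.
elim: s => [_|i s IH] //= /andP[si us].
apply: contraNneq (IH us) => e0.
have := c'c i i (fock_word s); rewrite e0 linear0 annihilate_notin // linear0.
by rewrite eqxx scale1r subr0 => <-.
Qed.

(* The number operators [c i \o c' i] separate the Fock vectors. *)
Lemma fock_free (k : {set 'I_m} -> K) :
  \sum_A k A *: fock A = 0 -> forall A, k A = 0.
Proof.
move=> k0 A0.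
(* Each further number operator splits the relation into the sets that contain [i] and those that do
   not; keeping the part that agrees with [A0] finally isolates [A0]. *)
have sel (s : seq 'I_m) :
    \sum_(A : {set 'I_m} | all (fun i => (i \in A) == (i \in A0)) s) k A *: fock A = 0.
  elim: s => [|i s IH] //=.
  pose Q (A : {set 'I_m}) := all (fun i => (i \in A) == (i \in A0)) s.
  have Qi : \sum_(A | Q A && (i \in A)) k A *: fock A = 0.
    have := congr1 (fun x => c i (c' i x)) IH; rewrite !linear0; apply: etrans.
    rewrite !linear_sum /= big_mkcondr; apply: eq_bigr => A _.
    rewrite !linearZ /= number_fock_word ?enum_uniq // mem_enum.
    by case: (i \in A); rewrite ?scale1r // scale0r scaler0.
  under eq_bigl do rewrite andbC.
  case: (i \in A0); first by under eq_bigl do rewrite eqb_id; exact: Qi.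
  move: IH; rewrite (bigID (fun A : {set 'I_m} => i \in A)) /= Qi add0r; apply: etrans.
  by apply: eq_bigl => A; rewrite eqbF_neg.
have := sel (enum 'I_m); rewrite (big_pred1 A0) => [|A].
  by move/eqP; rewrite scaler_eq0 (negPf (fock_word_neq0 (enum_uniq _))) orbF => /eqP.
apply/allP/eqP => [e|-> i _]; last exact: eqxx.
by apply/setP => i; apply/eqP/e; rewrite mem_enum.
Qed.

Lemma fock_eigen (V : 'End(U)) (mu : 'I_m -> K) (L : K) s :
    (forall i x, V (c i x) = mu i *: c i (V x)) -> V vac = L *: vac ->
  V (fock_word s) = (L * \prod_(i <- s) mu i) *: fock_word s.
Proof.
move=> Vc Vvac; elim: s => [|i s IH] /=; first by rewrite big_nil mulr1.
by rewrite Vc IH linearZ /= scalerA big_cons mulrCA.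
Qed.

End FockVectors.

Section ExteriorBasis.
Variables (K : fieldType) (J : finType) (m d : nat).
Local Notation X := {ffun J -> K^o}.
Local Notation T := {ffun {n : 'I_d.+1 & n.-tuple J} -> K^o}.
Variable w : 'I_m -> X.

Lemma wedge_det n (v : 'I_n -> X) t :
  wedge v t = \det (\matrix_(i, j) v j (tnth t i)).
Proof. by rewrite ffunE; apply: eq_bigr => s _; under [in RHS]eq_bigr do rewrite mxE. Qed.

Lemma wedge_repeat n (v : 'I_n -> X) i j : i != j -> v i = v j -> wedge v = 0.
Proof.
move=> ij vij; apply/ffunP => t; rewrite wedge_det ffunE -det_tr.
by apply: (determinant_alternate ij) => k; rewrite !mxE vij.
Qed.

Lemma wedge_perm n (v : 'I_n -> X) (s : 'S_n) :
  wedge (fun i => v (s i)) = (-1) ^+ s *: wedge v.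
Proof.
apply/ffunP => t; rewrite !ffunE scaler_sumr.
rewrite (reindex_inj (mulIg s^-1%g)) /=; apply: eq_bigr => r _.
rewrite odd_permM odd_permV signr_addb [_ * (-1) ^+ s]mulrC /GRing.scale /= -mulrA.
by congr (_ * (_ * _)); apply: eq_bigr => i _; rewrite permM permKV.
Qed.

Lemma wedge_sum n (a : 'I_n -> 'I_m -> K) :
  wedge (fun i => \sum_j a i j *: w j)
  = \sum_(f : {ffun 'I_n -> 'I_m}) (\prod_i a i (f i)) *: wedge (fun i => w (f i)).
Proof.
(* Moving the permutation from the vectors to the tuple makes the i-th factor depend on [v i] alone,
   so that the product of sums distributes. *)
have wedgeV (v : 'I_n -> X) t : wedge v t =
    \sum_(s : 'S_n) (-1) ^+ s * \prod_(i < n) v i (tnth t ((s^-1)%g i)).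
  rewrite ffunE; apply: eq_bigr => s _; congr (_ * _).
  by rewrite [RHS](reindex_inj (@perm_inj _ s)); apply: eq_bigr => i _; rewrite permK.
apply/ffunP => t; rewrite wedgeV sum_ffunE.
under [RHS]eq_bigr => f _ do rewrite ffunE wedgeV scaler_sumr.
rewrite exchange_big; apply: eq_bigr => s _ /=.
under eq_bigr => i _ do rewrite sum_ffunE.
rewrite bigA_distr_bigA mulr_sumr; apply: eq_bigr => f _ /=.
rewrite [RHS]mulrCA -big_split; congr (_ * _).
by apply: eq_bigr => i _; rewrite ffunE.
Qed.

Lemma wedge_pairing n (l : 'I_n -> J -> K) (v : 'I_n -> X) :
  \sum_t (\prod_i l i (tnth t i)) * wedge v t
  = \det (\matrix_(i, j) \sum_x l i x * v j x).
Proof.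
under eq_bigr do rewrite ffunE mulr_sumr.
rewrite exchange_big; apply: eq_bigr => s _ /=.
under [in RHS]eq_bigr do rewrite mxE.
rewrite bigA_distr_bigA mulr_sumr.
rewrite (reindex (fun u : n.-tuple J => [ffun i => tnth u i])) /=; last first.
  exists (fun g : {ffun 'I_n -> J} => [tuple g i | i < n]) => u _.
    by apply: eq_from_tnth => i; rewrite tnth_mktuple ffunE.
  by apply/ffunP=> i; rewrite ffunE tnth_mktuple.
apply: eq_bigr => u _; rewrite mulrCA -big_split; congr (_ * _).
by apply: eq_bigr => i _; rewrite ffunE.
Qed.

Definition wedge_seq (s : seq 'I_m) n : {ffun n.-tuple J -> K^o} :=
  wedge (fun i : 'I_n => (map w s)`_i).

(** The intended image of [fock A], homogeneous of degree [#|A|]. *)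
Definition ext_vec (A : {set 'I_m}) : T :=
  [ffun u : {n : 'I_d.+1 & n.-tuple J} =>
    if #|A| == tag u then wedge_seq (enum A) (tag u) (tagged u) else 0].

Lemma degree_ext_vec n A :
  degree K J n (ext_vec A) = if #|A| == n then wedge_seq (enum A) n else 0.
Proof. by apply/ffunP => t; rewrite degreeE ffunE /=; case: ifP; rewrite ?ffunE. Qed.

Lemma Gamma_ext_vec (f : 'End(X)) (mu : 'I_m -> K) A :
    (forall i, f (w i) = mu i *: w i) ->
  Gamma d f (ext_vec A) = (\prod_(i <- enum A) mu i) *: ext_vec A.
Proof.
move=> fw; apply/ffunP => -[n t].
rewrite -[LHS]degreeE degree_Gamma degree_ext_vec !ffunE /=.
case: eqP => [An|_]; last by rewrite linear0 ffunE scaler0.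
rewrite tpow_wedge !ffunE scaler_sumr; apply: eq_bigr => s _.
rewrite /GRing.scale /= mulrCA; congr (_ * _).
have sE : size (enum A) = n by rewrite -cardE.
have muE : \prod_(i <- enum A) mu i = \prod_(i < n) (map mu (enum A))`_(s i).
  rewrite -(big_map mu xpredT id) (big_nth 0) size_map sE big_mkord.
  by rewrite (reindex_inj (@perm_inj _ s)).
rewrite muE -big_split; apply: eq_bigr => i _ /=.
have sn : (s i < size (enum A))%N by rewrite sE.
have x0 : 'I_m by move: sn; case: (enum A) => // x.
by rewrite !(nth_map x0) // fw ffunE.
Qed.

Hypothesis dm : (m <= d)%N.
Variable W : {vspace X}.
Hypothesis WE : W = (\sum_i <[w i]>)%VS.

Let wW i : w i \in W.
Proof. by rewrite WE (subvP (sumv_sup i isT (subvv _))) // memv_line. Qed.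

Lemma ext_vec_extalg A : ext_vec A \in extalg d W.
Proof.
rewrite /extalg memvE; apply/subv_bigcapP => n _; rewrite -memvE -memv_preim.
rewrite degree_ext_vec; case: ifP => [/eqP An|_]; last exact: mem0v.
have [inW _] := vspanP (fun x => exists2 v : 'I_n -> X,
  (forall i, v i \in W) & x = wedge v).
apply: inW; exists (fun i : 'I_n => (map w (enum A))`_i) => // i.
have sn : (i < size (enum A))%N by rewrite -cardE An.
have x0 : 'I_m by move: sn; case: (enum A) => // x.
by rewrite (nth_map x0).
Qed.

(** Multilinearity reduces to wedges of the [w j]: a repeated vector gives zero, and distinct ones
    are sorted into the order of [enum] at the price of a sign. *)
Let extpow_span n x : x \in extpow n W ->
  exists k : {set 'I_m} -> K, x = \sum_(A : {set 'I_m} | #|A| == n) k A *: wedge_seq (enum A) n.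
Proof.
suff /subvP sub : (extpow n W <=
    \sum_(A : {set 'I_m} | #|A| == n) <[wedge_seq (enum A) n]>)%VS.
  move=> /sub/memv_sumP[y yP ->].
  have ky (A : {set 'I_m}) : exists k, #|A| == n -> y A = k *: wedge_seq (enum A) n.
    have [An|_] := boolP (#|A| == n); last by exists 0.
    by have /vlineP[k ->] := yP A An; exists k.
  have [k kP] := boolp.choice ky; exists k; apply: eq_bigr => A; exact: kP.
have [_] := vspanP (fun x => exists2 v : 'I_n -> X,
  (forall i, v i \in W) & x = wedge v).
apply=> _ [v vW ->].
have va i : exists a : 'I_m -> K, v i = \sum_j a j *: w j.
  have /memv_sumP[y yP ->] : v i \in (\sum_j <[w j]>)%VS by rewrite -WE.
  have ky j : exists k, y j = k *: w j by have /vlineP := yP j isT.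
  by have [k kP] := boolp.choice ky; exists k; apply: eq_bigr => j _; rewrite kP.
have [a aP] := boolp.choice va.
have -> : wedge v = wedge (fun i => \sum_j a i j *: w j).
  by congr wedge; apply/boolp.funext.
rewrite wedge_sum; apply: rpred_sum => f _; apply: rpredZ.
have [/injectiveP f_inj|] := boolP (injectiveb f); last first.
  by case/injectivePn => i [j ij fij]; rewrite (wedge_repeat ij) ?mem0v // fij.
pose A := [set f i | i : 'I_n].
have An : #|A| = n by rewrite card_imset // card_ord.
have sA i : (index (f i) (enum A) < n)%N.
  by rewrite -[X in (_ < X)%N]An cardE index_mem mem_enum imset_f.
pose s0 i := Ordinal (sA i).
have s_inj : injective s0.
  move=> i j [] /(congr1 (nth (f i) (enum A))).
  by rewrite !nth_index ?mem_enum ?imset_f // => /f_inj.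
have -> : wedge (fun i => w (f i)) = wedge (fun i => (map w (enum A))`_(perm s_inj i)).
  congr wedge; apply/boolp.funext => i; rewrite permE /=.
  by rewrite (nth_map (f i)) ?nth_index ?mem_enum ?imset_f // -cardE An.
rewrite (wedge_perm (fun i : 'I_n => (map w (enum A))`_i)); apply: rpredZ.
apply: (subvP (sumv_sup A _ (subvv _))); first by rewrite An.
exact: memv_line.
Qed.

Lemma extalg_span x : x \in extalg d W ->
  exists k : {set 'I_m} -> K, x = \sum_A k A *: ext_vec A.
Proof.
rewrite /extalg memvE => /subv_bigcapP xP.
have kx (n : 'I_d.+1) : exists k : {set 'I_m} -> K,
    degree K J n x = \sum_(A : {set 'I_m} | #|A| == n) k A *: wedge_seq (enum A) n.
  by apply: extpow_span; have := xP n isT; rewrite -memvE -memv_preim.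
have [k kP] := boolp.choice kx.
(* Each set contributes in the single degree [#|A|]; the default of [inord] is harmless, since
   [ext_vec A] vanishes when [#|A|] exceeds [d]. *)
exists (fun A : {set 'I_m} => k (inord #|A|) A); apply/ffunP => -[n t].
rewrite -[LHS]degreeE kP !sum_ffunE big_mkcond; apply: eq_bigr => A _.
rewrite !ffunE /=; case: eqP => [An|_]; last by rewrite scaler0.
by rewrite An inord_val.
Qed.

Hypothesis w_dual : exists l : 'I_m -> J -> K,
  forall i j, \sum_x l i x * w j x = (i == j)%:R.

(** The functionals dual to the [w j] with [j] in [B], tensored in degree [#|B|], take the value 1
    on [ext_vec B] and 0 on the other vectors; [m <= d] keeps this degree in range. *)
Lemma ext_vec_free (k : {set 'I_m} -> K) :
  \sum_A k A *: ext_vec A = 0 -> forall A, k A = 0.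
Proof.
have [l lw] := w_dual => k0 B.
have Bd : (#|B| < d.+1)%N.
  by rewrite ltnS (leq_trans _ dm) // -[X in (_ <= X)%N]card_ord max_card.
pose n := Ordinal Bd; pose l' (i : 'I_#|B|) := l (enum_val i).
pose L (y : {ffun n.-tuple J -> K^o}) := \sum_t (\prod_i l' i (tnth t i)) * y t.
have seqE (A : {set 'I_m}) (j : 'I_#|A|) : (map w (enum A))`_j = w (enum_val j).
  by rewrite (nth_map (enum_val j)) -?cardE // -enum_val_nth.
have LE A : L (degree K J n (ext_vec A)) = (A == B)%:R.
  rewrite degree_ext_vec /=; have [->|AB] := eqVneq A B.
    rewrite eqxx /L /wedge_seq wedge_pairing -[RHS](det1 _ #|B|); congr (\det _).
    apply/matrixP => i j; rewrite !mxE seqE lw; congr (_%:R).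
    by rewrite (inj_eq enum_val_inj).
  case: eqP => [An|_]; last by rewrite /L big1 // => t _; rewrite ffunE mulr0.
  (* For another set of the same size, an element of [B] outside [A] gives a zero row in the
     determinant. *)
  have /subsetPn[i0 i0B i0A] : ~~ (B \subset A).
    apply: contra AB => BA; rewrite eq_sym.
    by rewrite eqEcard BA An leqnn.
  rewrite /L /wedge_seq wedge_pairing (expand_det_row _ (enum_rank_in i0B i0)).
  rewrite big1 // => j _; rewrite mxE /l' enum_rankK_in //.
  have jA : (j < #|A|)%N by rewrite An.
  rewrite (seqE A (Ordinal jA)) lw; case: eqP => [i0E|_]; last by rewrite mul0r.
  by case/negP: i0A; rewrite {1}i0E enum_valP.
have := congr1 (fun x => L (degree K J n x)) k0.
rewrite linear_sum linear0 /L.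
under eq_bigr do rewrite sum_ffunE mulr_sumr.
rewrite exchange_big [RHS]big1 => [|t _]; last by rewrite ffunE mulr0.
rewrite (bigD1 B) //= [X in _ + X]big1 => [|A AB]; last first.
  transitivity (k A * L (degree K J n (ext_vec A))); last by rewrite LE (negPf AB) mulr0.
  by rewrite mulr_sumr; apply: eq_bigr => t _; rewrite linearZ ffunE mulrCA.
rewrite addr0 => <-; transitivity (k B * L (degree K J n (ext_vec B))).
  by rewrite LE eqxx mulr1.
by rewrite mulr_sumr; apply: eq_bigr => t _; rewrite linearZ ffunE mulrCA.
Qed.

End ExteriorBasis.

(** * The propagator *)

Section Transport.
Variables (K : numFieldType) (m : nat) (al : K).
Hypotheses (al0 : al != 0) (al1 : 1 - al ^+ 2 != 0).
Local Notation row := ('I_m * 'I_2 -> K).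

(* [f] and [g] are the values on a row and on the next one; the vertical edge at
   the [n]-th site carries [lambda (u n - i v n)]. *)
Definition transport (f g : row) (u v : nat -> K) : Prop :=
  [/\ u 0%N = 0, v m = 0 & forall k : 'I_m,
    [/\ al * f (k, ord0) + f (k, ord_max) = u k.+1 - al * v k.+1,
        al * f (k, ord0) - f (k, ord_max) = v k - al * u k,
        g (k, ord0) + al * g (k, ord_max) = u k.+1 + al * v k.+1
      & g (k, ord0) - al * g (k, ord_max) = al * u k + v k]].

Definition pairing (f g : row) : K :=
  \sum_(k < m) (f (k, ord0) * g (k, ord_max) + f (k, ord_max) * g (k, ord0)).

Lemma sum_row (F : 'I_m * 'I_2 -> K) :
  \sum_j F j = \sum_(k < m) (F (k, ord0) + F (k, ord_max)).
Proof.
rewrite (eq_bigr (fun j => F (j.1, j.2))) => [|[]//].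
rewrite -(pair_bigA _ (fun k i => F (k, i))) /=; apply: eq_bigr => k _.
by rewrite big_ord_recl big_ord1; congr (_ + F (k, _)); apply: val_inj.
Qed.

Lemma sum_telescope (F : nat -> K) : \sum_(k < m) (F k.+1 - F k) = F m - F 0%N.
Proof.
by rewrite -(big_mkord xpredT (fun k => F k.+1 - F k)) telescope_sumr.
Qed.

(** On each face, [2 * al] times the form is a difference of products of left-hand sides of the
    transport equations. After substitution, the change between rows is the discrete derivative of
    [F], which vanishes at both ends. *)
Lemma transport_pairing f g u v f' g' u' v' :
  transport f g u v -> transport f' g' u' v' -> pairing g g' = pairing f f'.
Proof.
move=> [u0 vm E] [u'0 v'm E'].
have al2 : 2 * al != 0 by rewrite mulf_neq0 ?pnatr_eq0.
apply/(mulfI al2)/eqP; rewrite -subr_eq0; apply/eqP.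
pose F n := 2 * al * (u n * v' n + v n * u' n).
transitivity (\sum_(k < m) (F k.+1 - F k)); last first.
  by rewrite sum_telescope /F u0 u'0 vm v'm !(mulr0, mul0r, addr0, subr0).
rewrite /pairing !mulr_sumr -sumrB; apply: eq_bigr => k _.
have [e1 e2 e3 e4] := E k; have [e1' e2' e3' e4'] := E' k.
transitivity
  ((g (k, ord0) + al * g (k, ord_max)) * (g' (k, ord0) + al * g' (k, ord_max))
   - (g (k, ord0) - al * g (k, ord_max)) * (g' (k, ord0) - al * g' (k, ord_max))
   - ((al * f (k, ord0) + f (k, ord_max)) * (al * f' (k, ord0) + f' (k, ord_max))
     - (al * f (k, ord0) - f (k, ord_max)) * (al * f' (k, ord0) - f' (k, ord_max)))).
  by ring.
by rewrite e1 e2 e3 e4 e1' e2' e3' e4' /F; ring.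
Qed.

Let transport_dot f g u v f' g' u' v' :
    transport f g u v -> transport f' g' u' v' ->
  2 * al * \sum_j g j * f' j = \sum_(k < m)
    ((u k.+1 + al * v k.+1) * (u' k.+1 - al * v' k.+1)
     + (al * u k + v k) * (v' k - al * u' k)).
Proof.
move=> [u0 vm E] [u'0 v'm E']; rewrite sum_row mulr_sumr; apply: eq_bigr => k _.
have [e1 e2 e3 e4] := E k; have [e1' e2' e3' e4'] := E' k.
by rewrite -e3 -e4 -e1' -e2'; ring.
Qed.

(* Each summand splits into a part symmetric under exchanging the two solutions
   and a discrete derivative, whose sum vanishes by the boundary conditions. *)
Lemma transport_sym f g u v f' g' u' v' :
    transport f g u v -> transport f' g' u' v' ->
  \sum_j g j * f' j = \sum_j f j * g' j.
Proof.
move=> T T'; have al2 : 2 * al != 0 by rewrite mulf_neq0 ?pnatr_eq0.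
have [[u0 vm _] [u'0 v'm _]] := (T, T').
under [RHS]eq_bigr do rewrite mulrC.
apply/(mulfI al2)/eqP; rewrite (transport_dot T T') (transport_dot T' T).
rewrite -subr_eq0 -sumrB; apply/eqP.
pose F n := 2 * al * (v n * u' n - u n * v' n).
transitivity (\sum_(k < m) (F k.+1 - F k)); last first.
  by rewrite sum_telescope /F u0 u'0 vm v'm !(mulr0, mul0r, addr0, subr0).
by apply: eq_bigr => k _; rewrite /F; ring.
Qed.

(** The source of positivity: telescoping moves the terms of weight [- al ^+ 2] to the opposite end
    of each face, which leaves only nonnegative weights when [0 < al < 1]. *)
Lemma transport_energy f g u v f' g' u' v' :
    transport f g u v -> transport f' g' u' v' ->
  2 * al * \sum_j g j * f' j =
    (1 - al ^+ 2) * \sum_(k < m) (u k.+1 * u' k.+1 + v k * v' k)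
    + al ^+ 2 * (u m * u' m + v 0%N * v' 0%N).
Proof.
move=> T T'; rewrite (transport_dot T T').
have [[u0 vm _] [u'0 v'm _]] := (T, T').
pose F n := al * (v n * u' n - u n * v' n) + al ^+ 2 * (u n * u' n - v n * v' n).
have FE : al ^+ 2 * (u m * u' m + v 0%N * v' 0%N) = \sum_(k < m) (F k.+1 - F k).
  by rewrite sum_telescope /F u0 u'0 vm v'm; ring.
rewrite FE mulr_sumr -big_split; apply: eq_bigr => k _.
by rewrite /F /=; ring.
Qed.

(* Reflection across the horizontal line through the vertical edges. *)
Lemma transport_reverse f g u v f' g' : transport f g u v ->
    (forall k, f' (k, ord0) = g (k, ord_max) /\ f' (k, ord_max) = g (k, ord0)) ->
    (forall k, g' (k, ord0) = f (k, ord_max) /\ g' (k, ord_max) = f (k, ord0)) ->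
  transport f' g' u (fun n => - v n).
Proof.
move=> [u0 vm E] f'E g'E; split=> [//||k]; first by rewrite vm oppr0.
have [e1 e2 e3 e4] := E k; have [-> ->] := f'E k; have [-> ->] := g'E k.
split.
- by rewrite mulrN opprK -e3 addrC.
- by rewrite -[LHS]opprB e4 opprD addrC.
- by rewrite mulrN -e1 addrC.
by rewrite -opprB e2 opprB.
Qed.

(** At an interior site the two adjacent faces give [u - al v] and [v - al u], a system of
    determinant [1 - al ^+ 2]; at an end the boundary condition replaces one of them. The vertical
    values then determine the next row. *)
Lemma transport_unique f g u v g' u' v' :
  transport f g u v -> transport f g' u' v' -> g =1 g'.
Proof.
move=> [u0 vm E] [u'0 v'm E'].
have uvE n : (n <= m)%N -> (0 < m)%N -> u n = u' n /\ v n = v' n.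
  move=> nm m0; have U : (0 < n)%N -> u n - al * v n = u' n - al * v' n.
    move=> n0; have ltnm : (n.-1 < m)%N by rewrite prednK.
    have := E (Ordinal ltnm); have := E' (Ordinal ltnm).
    by rewrite /= prednK // => -[<- _ _ _] [<-].
  have V : (n < m)%N -> v n - al * u n = v' n - al * u' n.
    move=> ltnm; have := E (Ordinal ltnm); have := E' (Ordinal ltnm).
    by rewrite /= => -[_ <- _ _] [_ <-].
  have [n0|n0] := posnP n.
    by move: V; rewrite n0 u0 u'0 mulr0 !subr0; split=> //; apply: V.
  have [nE|nNm] := eqVneq n m.
    by move: U; rewrite nE vm v'm mulr0 !subr0; split=> //; apply: U; rewrite -nE.
  have {}U := U n0; have {}V : v n - al * u n = v' n - al * u' n.
    by apply: V; rewrite ltn_neqAle nNm.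
  split; apply: (mulfI al1).
    transitivity (u n - al * v n + al * (v n - al * u n)); first by ring.
    by rewrite U V; ring.
  transitivity (v n - al * u n + al * (u n - al * v n)); first by ring.
  by rewrite U V; ring.
have two0 : (2 : K) != 0 by rewrite pnatr_eq0.
have al2 : 2 * al != 0 by rewrite mulf_neq0.
case=> k i; have m0 : (0 < m)%N by apply: leq_ltn_trans (ltn_ord k).
have [_ _ e3 e4] := E k; have [_ _ e3' e4'] := E' k.
have [U1 V1] := uvE k.+1 (ltn_ord k) m0; have [U V] := uvE k (ltnW (ltn_ord k)) m0.
have {}e3 : g (k, ord0) + al * g (k, ord_max) = g' (k, ord0) + al * g' (k, ord_max).
  by rewrite e3 e3' U1 V1.
have {}e4 : g (k, ord0) - al * g (k, ord_max) = g' (k, ord0) - al * g' (k, ord_max).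
  by rewrite e4 e4' U V.
have [->|->] : i = ord0 \/ i = ord_max.
- by case: i => -[|[|//]] p; [left|right]; apply: val_inj.
- apply: (mulfI two0); transitivity (g (k, ord0) + al * g (k, ord_max)
    + (g (k, ord0) - al * g (k, ord_max))); first by ring.
  by rewrite e3 e4; ring.
apply: (mulfI al2); transitivity (g (k, ord0) + al * g (k, ord_max)
  - (g (k, ord0) - al * g (k, ord_max))); first by ring.
by rewrite e3 e4; ring.
Qed.

(* From the left boundary, [u = 0] and [f (k, 1) = - f (k, 0)] propagate to the
   right; the right boundary then forces [f = 0], propagating back to the left. *)
Lemma transport_fixed f u v : transport f f u v -> f =1 fun=> 0.
Proof.
move=> [u0 vm E].
have two0 : (2 : K) != 0 by rewrite pnatr_eq0.
have al1' : 1 - al != 0.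
  by apply: contra al1 => /eqP h; rewrite -(expr1n _ 2%N) subr_sqr h mul0r.
have step (k : 'I_m) : u k = 0 -> f (k, ord_max) = - f (k, ord0) /\ u k.+1 = 0.
  move=> uk; have [e1 e2 e3 e4] := E k.
  have y : f (k, ord_max) = - f (k, ord0).
    apply: (mulfI al1'); apply/eqP; rewrite -subr_eq0; apply/eqP.
    transitivity (f (k, ord0) - al * f (k, ord_max)
                  - (al * f (k, ord0) - f (k, ord_max))); first by ring.
    by rewrite e2 e4 uk; ring.
  split=> //; apply: (mulfI two0).
  transitivity (u k.+1 - al * v k.+1 + (u k.+1 + al * v k.+1)); first by ring.
  by rewrite -e1 -e3 y; ring.
have uz n : (n <= m)%N -> u n = 0.
  elim: n => // n IH nm.
  by have [] := step (Ordinal nm) (IH (ltnW nm)).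
have vz n : (n <= m)%N -> v n = 0 /\
    forall k : 'I_m, (n <= k)%N -> f (k, ord0) = 0 /\ f (k, ord_max) = 0.
  move=> nm; rewrite -(subKn nm); elim: (m - n)%N (leq_subr n m) => [|p IH] pm.
    by rewrite subn0; split=> // k mk; move: (ltn_ord k); rewrite ltnNge mk.
  have [vp fp] := IH (ltnW pm).
  have qE : (m - p)%N = (m - p.+1).+1 by rewrite subnSK.
  have qm : (m - p.+1 < m)%N by rewrite -qE leq_subr.
  set k := Ordinal qm; have [e1 e2 _ _] := E k.
  have [y _] := step k (uz _ (ltnW qm)).
  have x : f (k, ord0) = 0.
    apply: (mulfI al1'); rewrite mulr0.
    transitivity (- (al * f (k, ord0) + f (k, ord_max))); first by rewrite y; ring.
    by rewrite e1 /= -qE uz ?leq_subr // vp; ring.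
  rewrite x oppr0 in y; split.
    by move: e2; rewrite x y /= uz ?(ltnW qm) // !(mulr0, subr0) => <-.
  move=> k'; rewrite leq_eqVlt => /predU1P[kk'|].
    by have -> : k' = k by apply: val_inj.
  by rewrite -qE => /fp.
case=> k i; have [_ /(_ k (leq0n _))[x y]] := vz 0%N (leq0n _).
have [->|-> //] : i = ord0 \/ i = ord_max.
  by case: i => -[|[|//]] p; [left|right]; apply: val_inj.
by [].
Qed.

End Transport.

(** * Massive s-holomorphicity in real coordinates *)

Section Faces.
Variables (R : realType) (beta : R).
Local Notation l := (lambda R).
Local Notation al := (alpha beta).
Local Notation w1 := (al%:C - 'i%C).
Local Notation w2 := (al%:C + 'i%C).

(** With denominators cleared, and up to powers of [lambda], each side is a number plus or minus its
    conjugate, so one real relation remains. The next three lemmas follow the same scheme. *)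
Lemma north_east_real (x y u v : R) (N := x +i* y) (E := l * (u -i* v)) :
  N + (nu beta)^-1 * l * N^*%C = (nu beta)^-1 * E + l * E^*%C ->
  x + al * y = u + al * v.
Proof.
rewrite nuVE => eq1.
have : w2 * N + l ^+ 4 * w1 * N^*%C = l ^+ 4 * w1 * (u -i* v) + w2 * (u +i* v).
  transitivity (w2 * (N + l ^+ 3 * w1 / w2 * l * N^*%C)); first by field; exact: u_neq0.
  rewrite eq1 /E conjcM lambdaJ /= opprK; field.
  by rewrite lambda_neq0 u_neq0.
rewrite lambda4 /N => /eqP; rewrite eq_complex /= => /andP[/eqP h1 /eqP h2].
lra.
Qed.

Lemma north_west_real (x y u v : R) (N := x +i* y) (W := l * (u -i* v)) :
  N + nu beta * l^-1 * N^*%C = nu beta * W + l^-1 * W^*%C ->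
  x - al * y = al * u + v.
Proof.
rewrite nuE => eq1.
have : l ^+ 4 * w1 * N + w2 * N^*%C
    = l ^+ 2 * (w2 * (u -i* v) + w1 * (u +i* v)).
  transitivity (l ^+ 4 * w1 * (N + w2 / (l ^+ 3 * w1) * l^-1 * N^*%C)).
    by field; rewrite lambda_neq0 w_neq0.
  rewrite eq1 /W conjcM lambdaJ /= opprK; field.
  by rewrite lambda_neq0 w_neq0.
rewrite lambda4 lambda_sqr /N => /eqP; rewrite eq_complex /= => /andP[/eqP h1 /eqP h2].
lra.
Qed.

Lemma south_east_real (x y u v : R) (S := x +i* y) (E := l * (u -i* v)) :
  S + nu beta * l ^+ 3 * S^*%C = nu beta * E + l ^+ 3 * E^*%C ->
  al * x + y = u - al * v.
Proof.
rewrite nuE => eq1.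
have : l ^+ 2 * (w1 * S + w2 * S^*%C)
    = w2 * (u -i* v) + l ^+ 4 * w1 * (u +i* v).
  transitivity (l ^+ 2 * w1 * (S + w2 / (l ^+ 3 * w1) * l ^+ 3 * S^*%C)).
    by field; rewrite lambda_neq0 w_neq0.
  rewrite eq1 /E conjcM lambdaJ /= opprK; field.
  by rewrite lambda_neq0 w_neq0.
rewrite lambda4 lambda_sqr /S => /eqP; rewrite eq_complex /= => /andP[/eqP h1 /eqP h2].
lra.
Qed.

Lemma south_west_real (x y u v : R) (S := x +i* y) (W := l * (u -i* v)) :
  S + (nu beta)^-1 * l ^- 3 * S^*%C = (nu beta)^-1 * W + l ^- 3 * W^*%C ->
  al * x - y = v - al * u.
Proof.
rewrite nuVE => eq1.
have : l ^+ 4 * (w2 * S + w1 * S^*%C)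
    = (l ^+ 4) ^+ 2 * w1 * (u -i* v) + w2 * (u +i* v).
  transitivity (l ^+ 4 * w2 * (S + l ^+ 3 * w1 / w2 * l ^- 3 * S^*%C)).
    by field; rewrite lambda_neq0 u_neq0.
  rewrite eq1 /W conjcM lambdaJ /= opprK; field.
  by rewrite lambda_neq0 u_neq0.
rewrite lambda4 /S => /eqP; rewrite eq_complex /= => /andP[/eqP h1 /eqP h2].
lra.
Qed.

End Faces.

Section PropagatorTransport.
Variables (R : realType) (a b : int) (beta : R).
Hypotheses (ab : a < b) (beta_gt0 : 0 < beta).
Local Notation m := (`|b - a|%N).
Local Notation l := (lambda R).
Local Notation al := (alpha beta).

Lemma alpha_gt0 : 0 < al. Proof. exact: expR_gt0. Qed.

Lemma alpha_lt1 : al < 1.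
Proof. by rewrite /alpha -[ltRHS]expR0 ltr_expR mulNr oppr_lt0 mulr_gt0. Qed.

Lemma propagation_transport (f g : {ffun 'I_m * 'I_2 -> R^o}) :
  is_propagation beta f g -> exists u v, transport (al : R) f g u v.
Proof.
move=> [h [hf hc hl hr] hg].
pose z n := h (site R a n +i* 2^-1).
pose u n := complex.Re (l^-1 * z n); pose v n := - complex.Im (l^-1 * z n).
have zE n : z n = l * (u n -i* v n).
  by apply: (canRL (mulVKf (lambda_neq0 R))); rewrite /u /v opprK; case: (l^-1 * z n).
have bE : b%:~R = site R a m.
  by rewrite /site pmulrn -intrD gez0_abs ?subr_ge0 ?ltW //; congr (_ *~ _); ring.
have aE : a%:~R = site R a 0 by rewrite /site addr0.
have lV2 : l ^- 2 = -'i%C.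
  have i0 : 'i%C != 0 :> R[i] by rewrite eq_complex /= oner_eq0 andbF.
  by rewrite lambda_sqr; apply: (mulfI i0); rewrite divff // mulrN -expr2 sqr_i opprK.
exists u, v; split=> [||k].
(* On the left edge [l^-1 * z] is a real multiple of [l ^- 2 = - i], so [u] vanishes; on the right
   edge it is real, so [v] vanishes. *)
- have [t tE] := hl; rewrite /u /z -aE tE mulrCA -expr2 exprVn lV2.
  by rewrite /= !(mul0r, mulr0, oppr0, subr0).
- have [t tE] := hr; rewrite /v /z -bE tE mulrCA mulVf ?lambda_neq0 //.
  by rewrite mulr1 /= oppr0.
have half : (2^-1 : R[i]) = 2^-1 +i* 0.
  by rewrite complexr0 fmorphV rmorph_nat.
have d2 : 2^-1 + 2^-1 = 1 :> R by field.
have ihalf : 'i%C / 2 = 0 +i* 2^-1 :> R[i] by rewrite half; simpc.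
have dD n : dual_site R a n + 2^-1 = site R a n.+1.
  by rewrite /dual_site /site -[n.+1]addn1 natrD -addrA d2 addrA.
have dB n : dual_site R a n - 2^-1 = site R a n by rewrite /dual_site addrK.
have := hc k; rewrite /ms_holo; set c := dual_site R a k +i* 2^-1.
have -> : c + 2^-1 = site R a k.+1 +i* 2^-1 by rewrite half /c; simpc; rewrite dD.
have -> : c + 'i%C / 2 = dual_site R a k +i* 1.
  by rewrite ihalf /c; simpc; rewrite d2.
have -> : c - 2^-1 = site R a k +i* 2^-1 by rewrite half /c; simpc; rewrite dB.
have -> : c - 'i%C / 2 = dual_site R a k +i* 0.
  by rewrite ihalf /c; simpc; rewrite ?subrr.
rewrite hf hg -/(z k) -/(z k.+1) !zE /cvalue => -[e1 e2 e3 e4]; split.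
- exact: south_east_real e3.
- exact: south_west_real e4.
- exact: north_east_real e1.
exact: north_west_real e2.
Qed.

Local Notation P := (propagatorC a b beta).

(** The transport equations have real coefficients, so real and imaginary parts propagate
    separately. *)
Lemma propagatorC_transport (f : {ffun 'I_m * 'I_2 -> R[i]^o}) :
  exists u v, transport al%:C f (P f) u v.
Proof.
pose f1 : {ffun 'I_m * 'I_2 -> R^o} := [ffun j => complex.Re (f j)].
pose f2 : {ffun 'I_m * 'I_2 -> R^o} := [ffun j => complex.Im (f j)].
have [u1 [v1 [u10 v1m E1]]] := propagation_transport (propagatorP ab beta_gt0 f1).
have [u2 [v2 [u20 v2m E2]]] := propagation_transport (propagatorP ab beta_gt0 f2).
exists (fun n => u1 n +i* u2 n), (fun n => v1 n +i* v2 n).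
split; rewrite ?u10 ?u20 ?v1m ?v2m // => k.
have PE i : P f (k, i) = propagator beta f1 (k, i) +i* propagator beta f2 (k, i).
  by rewrite /propagatorC complexifyE //; apply: propagator_linear.
have fE i : f (k, i) = f1 (k, i) +i* f2 (k, i) by rewrite !ffunE; case: (f _).
have [e1 e2 e3 e4] := E1 k; have [h1 h2 h3 h4] := E2 k.
rewrite !PE !fE; simpc.
by split; congr (_ +i* _).
Qed.

End PropagatorTransport.

(** * Spectrum of the complexified propagator *)

Section Spectrum.
Variables (R : realType) (a b : int) (beta : R).
Hypotheses (ab : a < b) (beta_gt0 : 0 < beta).
Local Notation m := (`|b - a|%N).
Local Notation al := ((alpha beta)%:C).
Local Notation X := {ffun 'I_m * 'I_2 -> R[i]^o}.
Local Notation P := (propagatorC a b beta).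

Let al_gt0 : 0 < al. Proof. by rewrite ltcR alpha_gt0. Qed.
Let al0 : al != 0. Proof. by rewrite gt_eqF. Qed.
Let al1_gt0 : 0 < 1 - al ^+ 2.
Proof.
rewrite -rmorphXn -(rmorph1 (real_complex R)) -rmorphB ltcR subr_gt0.
by rewrite expr_lt1 ?ltW ?alpha_gt0 // alpha_lt1.
Qed.
Let al1 : 1 - al ^+ 2 != 0. Proof. by rewrite gt_eqF. Qed.

(* Turns the Hermitian product into the bilinear pairing, see [pairing_swapc]. *)
Definition swapc (f : X) : X := [ffun j => (f (j.1, rev_ord j.2))^*%C].

Let rev0 : rev_ord (@ord0 1) = ord_max. Proof. exact: val_inj. Qed.
Let revM : rev_ord (@ord_max 1) = ord0. Proof. exact: val_inj. Qed.

Lemma swapcZ c f : swapc (c *: f) = c^*%C *: swapc f.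
Proof. by apply/ffunP => j; rewrite !ffunE conjcM. Qed.

Lemma swapcK f : swapc (swapc f) = f.
Proof. by apply/ffunP => -[k i]; rewrite !ffunE /= conjcK rev_ordK. Qed.

Lemma pairing_swapc (f g : X) : pairing f (swapc g) = hdot f g.
Proof.
rewrite /hdot sum_row; apply: eq_bigr => k _.
by rewrite !ffunE /= rev0 revM.
Qed.

Lemma hdot_swapc f g : hdot (swapc f) (swapc g) = hdot g f.
Proof.
rewrite /hdot !sum_row; apply: eq_bigr => k _.
by rewrite !ffunE /= rev0 revM !conjcK [LHS]addrC; congr (_ + _); rewrite mulrC.
Qed.

Let conj_row (f : X) : X := [ffun j => (f j)^*%C].

Let transport_conj (f : X) u v : transport al f (P f) u v ->
  transport al (conj_row f) (conj_row (P f)) (fun n => (u n)^*%C) (fun n => (v n)^*%C).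
Proof.
move=> [u0 vm E]; split=> [||k]; rewrite ?u0 ?vm ?conjc0 //.
have [e1 e2 e3 e4] := E k; rewrite !ffunE -(conjc_real (alpha beta)).
by split; rewrite -!conjcM -?rmorphD -?rmorphB; congr (_^*%C).
Qed.

(** Conjugating the second solution turns the symmetry of the bilinear product into Hermitian
    symmetry. *)
Lemma propagatorC_sym f g : hdot (P f) g = hdot f (P g).
Proof.
have [u [v T]] := propagatorC_transport ab beta_gt0 f.
have [u' [v' /transport_conj T']] := propagatorC_transport ab beta_gt0 g.
have := transport_sym al0 T T'; rewrite /hdot.
by under eq_bigr do rewrite ffunE; under [in RHS]eq_bigr do rewrite ffunE.
Qed.

Lemma propagatorC_ge0 f : 0 <= hdot (P f) f.
Proof.
have [u [v T]] := propagatorC_transport ab beta_gt0 f.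
have al2 : 0 < 2 * al by rewrite mulr_gt0 // ltr0n.
rewrite -(pmulr_rge0 _ al2).
have := transport_energy T (transport_conj T).
under eq_bigr do rewrite ffunE; rewrite -/(hdot _ _) => ->.
rewrite addr_ge0 // mulr_ge0 ?(ltW al1_gt0) ?exprn_ge0 ?(ltW al_gt0) //.
  by apply: sumr_ge0 => k _; rewrite addr_ge0 ?mulcJ_ge0.
by rewrite addr_ge0 ?mulcJ_ge0.
Qed.

Lemma propagatorC_pairing f g : pairing (P f) (P g) = pairing f g.
Proof.
have [u [v T]] := propagatorC_transport ab beta_gt0 f.
have [u' [v' T']] := propagatorC_transport ab beta_gt0 g.
exact: (transport_pairing al0 T T').
Qed.

(** Reflecting the conjugated transport of [f] gives a transport from [swapc (P f)] to [swapc f],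
    and the next row is unique. Hence [swapc] inverts the eigenvalues. *)
Lemma propagatorC_swapc f : P (swapc (P f)) = swapc f.
Proof.
have [u [v /transport_conj T]] := propagatorC_transport ab beta_gt0 f.
have [u' [v' T']] := propagatorC_transport ab beta_gt0 (swapc (P f)).
apply/ffunP; apply: (transport_unique al0 al1 T').
apply: (transport_reverse T) => k; rewrite !ffunE /= rev0 revM //.
Qed.

Lemma propagatorC_fixed f : P f = f -> f = 0.
Proof.
have [u [v T]] := propagatorC_transport ab beta_gt0 f => Pf.
rewrite Pf in T; apply/ffunP => j.
by rewrite (transport_fixed al1 T) ffunE.
Qed.

(** As [swapc] exchanges eigenvalues below and above one, and one itself is excluded, exactly [m] of
    the [2 m] eigenvalues lie below one. The family [w'] is the image of [w] under [swapc], so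
    duality for [pairing] is orthonormality of [w]. *)
Lemma propagatorC_spectrum :
  exists (w w' : 'I_m -> X) (mu : 'I_m -> R),
    [/\ forall i, 0 < mu i < 1,
        forall i, P (w i) = (mu i)%:C *: w i,
        forall i, P (w' i) = (mu i)^-1%:C *: w' i,
        forall i j, pairing (w i) (w j) = 0 /\ pairing (w i) (w' j) = (i == j)%:R
      & Wcirc a b beta = (\sum_i <[w i]>)%VS].
Proof.
have [v [d [Pv vv vx]]] := hermitian_eigenbasis propagatorC_sym.
have v0 j : v j != 0 by apply: hdot1_neq0; rewrite vv eqxx.
have dPs j : (d j)%:C *: P (swapc (v j)) = swapc (v j).
  by have := propagatorC_swapc (v j); rewrite Pv swapcZ (conjc_real (d j)) linearZ.
have d_gt0 j : 0 < d j.
  rewrite lt_neqAle; apply/andP; split; last first.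
    have := propagatorC_ge0 (v j); rewrite Pv hdotZl vv eqxx mulr1.
    by rewrite lecR.
  apply: contraNneq (v0 j) => dj; have := dPs j; rewrite -dj scale0r => /esym s0.
  by rewrite -(swapcK (v j)) s0; apply/eqP/ffunP => i; rewrite !ffunE conjc0.
have d_neq1 j : d j != 1.
  apply: contraNneq (v0 j) => dj; apply/eqP/propagatorC_fixed.
  by rewrite Pv dj scale1r.
have Ps j : P (swapc (v j)) = (d j)^-1%:C *: swapc (v j).
  rewrite -{2}(dPs j) scalerA -rmorphM mulVf ?gt_eqF // scale1r //.
have orth x (c : R) k : P x = c%:C *: x -> c != d k -> hdot x (v k) = 0.
  move=> Px ck; have : (c%:C - (d k)%:C) * hdot x (v k) = 0.
    rewrite mulrBl -hdotZl -Px propagatorC_sym Pv hdotZr.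
    by rewrite (conjc_real (d k)) subrr.
  move/eqP; rewrite mulf_eq0 subr_eq0 => /orP[/eqP/complexI/eqP|/eqP //].
  by rewrite (negPf ck).
have in_span x (c : R) (B : {set 'I__}) : P x = c%:C *: x -> (forall k, d k = c -> k \in B) ->
    x \in (\sum_(k in B) <[v k]>)%VS.
  move=> Px cB; rewrite (vx x); apply: rpred_sum => k _.
  have [dk|dk] := eqVneq c (d k).
    by apply: (subvP (sumv_sup k (cB k (esym dk)) (subvv _))); rewrite memvZ // memv_line.
  by rewrite (orth x c) // scale0r mem0v.
pose A := [set k | d k < 1]; pose B := [set k | 1 < d k].
have swap_orth j k : hdot (swapc (v j)) (swapc (v k)) = (j == k)%:R.
  by rewrite hdot_swapc vv eq_sym.
(* The images of each family under [swapc] are orthonormal and lie in the span of the other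
   family. *)
have AB : #|A| = #|B|.
  apply/eqP; rewrite eqn_leq; apply/andP; split.
    apply: (@orthonormal_card _ _ _ A B (fun k => swapc (v k)) v) => // j.
    rewrite inE => dj; apply: in_span (Ps j) _ => k; rewrite inE => ->.
    by rewrite invf_gt1.
  apply: (@orthonormal_card _ _ _ B A (fun k => swapc (v k)) v) => // j.
  rewrite inE => dj; apply: in_span (Ps j) _ => k; rewrite inE => ->.
  by rewrite invf_lt1.
have Am : #|A| = m.
  have BC : B = ~: A.
    by apply/setP => k; rewrite !inE -leNgt lt_neqAle eq_sym d_neq1.
  have AA : (#|A| + #|A|)%N = (m * 2)%N.
    rewrite {2}AB BC (cardsC A).
    apply: (etrans (card_ord _)); apply: (etrans (card_prod _ _)).
    by congr (_ * _)%N; apply: card_ord.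
  by apply: double_inj; rewrite -addnn AA muln2.
pose e (i : 'I_m) := enum_val (cast_ord (esym Am) i).
have eA i : d (e i) < 1 by have := enum_valP (cast_ord (esym Am) i); rewrite inE.
have e_inj : injective e by move=> i j /enum_val_inj/cast_ord_inj.
have e_surj k : d k < 1 -> exists i, k = e i.
  move=> dk; have kA : k \in A by rewrite inE.
  exists (cast_ord Am (enum_rank_in kA k)).
  by rewrite /e cast_ordK enum_rankK_in.
exists (v \o e), (swapc \o v \o e), (d \o e); split=> [i|i|i|i j|] /=.
- by rewrite d_gt0 eA.
- exact: Pv.
- exact: Ps.
- split; last by rewrite pairing_swapc vv (inj_eq e_inj).
  (* Since [P] preserves the form, the pairing equals itself times a product of two eigenvalues
     below one. *)
  have : (1 - (d (e i) * d (e j))%:C) * pairing (v (e i)) (v (e j)) = 0.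
    have := propagatorC_pairing (v (e i)) (v (e j)); rewrite !Pv => pE.
    rewrite mulrBl mul1r -[X in X - _]pE; apply/eqP; rewrite subr_eq0; apply/eqP.
    by rewrite rmorphM /pairing mulr_sumr; apply: eq_bigr => k _;
      rewrite !ffunE /GRing.scale /=; ring.
  move/eqP; rewrite mulf_eq0 subr_eq0 -(rmorph1 (real_complex R)).
  case/orP=> [/eqP/complexI/esym/eqP|/eqP //].
  by rewrite lt_eqF // mulr_ilt1 // ltW.
have [inW minW] : is_span _ (Wcirc a b beta) := vspanP _.
apply/eqP; rewrite eqEsubv; apply/andP; split.
  apply: minW => x [x0 [c c1 Px]]; rewrite (vx x); apply: rpred_sum => k _.
  have [dk|dk] := eqVneq c (d k).
    have [|i ->] := e_surj k; first by rewrite -dk.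
    by apply: (subvP (sumv_sup i isT (subvv _))); rewrite memvZ // memv_line.
  by rewrite (orth x c) // scale0r mem0v.
apply/subv_sumP => i _; rewrite -memvE; apply: inW; split=> //.
by exists (d (e i)).
Qed.

End Spectrum.

(** * The transfer matrix *)

Section Fermions.
Variables (R : realType) (m : nat).
Local Notation config := {ffun 'I_m.+1 -> bool}.
Local Notation S := {ffun config -> R[i]^o}.
Local Notation X := {ffun 'I_m * 'I_2 -> R[i]^o}.

(** The dual site [n] lies between the sites [n] and [n.+1], hence the weak inequality. *)
Definition flip_left (n : nat) (s : config) : config :=
  [ffun i : 'I_m.+1 => if (i <= n)%N then ~~ s i else s i].

(* Meaningful only for [n <= m], because of [inord]. *)
Definition spin_at (s : config) (n : nat) : R := spin R (s (inord n)).

Lemma flipK n : involutive (flip_left n).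
Proof. by move=> s; apply/ffunP => i; rewrite !ffunE; case: (i <= n)%N; rewrite ?negbK. Qed.

Lemma flipC n k s : flip_left n (flip_left k s) = flip_left k (flip_left n s).
Proof. by apply/ffunP => i; rewrite !ffunE; do 2?case: ifP. Qed.

Lemma spinN c : spin R (~~ c) = - spin R c.
Proof. by case: c; rewrite /spin ?opprK. Qed.

Lemma spin_sqr c : spin R c * spin R c = 1.
Proof. by case: c; rewrite /spin ?mulrNN mulr1. Qed.

Lemma spin_at_flip_le k n s : (k <= n)%N -> (k <= m)%N -> spin_at (flip_left n s) k = - spin_at s k.
Proof. by move=> kn km; rewrite /spin_at ffunE inordK ?ltnS // kn spinN. Qed.

Lemma spin_at_flip_gt k n s : (n < k)%N -> (k <= m)%N -> spin_at (flip_left n s) k = spin_at s k.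
Proof. by move=> kn km; rewrite /spin_at ffunE inordK ?ltnS // leqNgt kn. Qed.

Lemma spin_at_sqr s n : spin_at s n * spin_at s n = 1. Proof. exact: spin_sqr. Qed.

(** Regroups [f(k,0) (p_k - q_k) + f(k,1) (p_k + q_k)] by [p_k] and [q_k]; the spins are read after
    the flip. *)
Definition fermion_coef (f : X) (k : 'I_m) (s : config) : R[i] :=
  (f (k, ord0) + f (k, ord_max)) * (spin_at s k.+1)%:C
  - (f (k, ord0) - f (k, ord_max)) * (spin_at s k)%:C.

Definition fermion (f : X) : 'End(S) :=
  linfun (fun x : S => [ffun s => \sum_k fermion_coef f k s * x (flip_left k s)] : S).

Lemma fermionE f (x : S) s : fermion f x s = \sum_k fermion_coef f k s * x (flip_left k s).
Proof.
rewrite linfunE ?ffunE // => c y z; apply/ffunP=> t; rewrite !ffunE.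
rewrite scaler_sumr -big_split; apply: eq_bigr => u _ /=.
by rewrite !ffunE mulrDr mulrCA.
Qed.

Lemma fermionZ c f x : fermion (c *: f) x = c *: fermion f x.
Proof.
apply/ffunP=> s; rewrite ffunE !fermionE scaler_sumr; apply: eq_bigr => k _.
by rewrite /fermion_coef !ffunE /GRing.scale /=; ring.
Qed.

(** The flip at [l] reverses both spins next to the dual site [k], while the flip at [k] reverses
    neither spin next to [l]. This asymmetry makes distinct sites anticommute. *)
Lemma fermion_coef_flip_lt f (k l : 'I_m) s : (k < l)%N ->
  fermion_coef f l (flip_left k s) = fermion_coef f l s
  /\ fermion_coef f k (flip_left l s) = - fermion_coef f k s.
Proof.
move=> kl; have [km lm] := (ltn_ord k, ltn_ord l); rewrite /fermion_coef; split.
  by rewrite !spin_at_flip_gt ?(ltnW lm) // (leq_trans kl).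
by rewrite !spin_at_flip_le ?(ltnW kl) ?(ltnW km) // !rmorphN /=; ring.
Qed.

(** Distinct sites cancel. At a single site the flip reverses only the spin on the left, so the
    cross terms cancel and the squared spins leave four times the summand of [pairing]. *)
Lemma fermion_anticommute f g x :
  fermion f (fermion g x) + fermion g (fermion f x) = (4 * pairing f g) *: x.
Proof.
apply/ffunP => s; rewrite !ffunE.
pose T (k l : 'I_m) := (fermion_coef f k s * fermion_coef g l (flip_left k s)
  + fermion_coef g l s * fermion_coef f k (flip_left l s)) * x (flip_left l (flip_left k s)).
transitivity (\sum_k \sum_l T k l).
  have fg (f1 g1 : X) : fermion f1 (fermion g1 x) s = \sum_k \sum_l
      fermion_coef f1 k s * fermion_coef g1 l (flip_left k s) * x (flip_left l (flip_left k s)).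
    rewrite fermionE; apply: eq_bigr => k _; rewrite fermionE mulr_sumr.
    by apply: eq_bigr => l _; rewrite mulrA.
  rewrite !fg [X in _ + X]exchange_big -big_split /=; apply: eq_bigr => k _.
  rewrite -big_split /=; apply: eq_bigr => l _.
  by rewrite /T (flipC k l) [RHS]mulrDl.
have T0 (k l : 'I_m) : k != l -> T k l = 0.
  rewrite /T => kl; have [ltkl|ltlk|kl'] := ltngtP k l; last by rewrite (val_inj kl') eqxx in kl.
    have [-> _] := fermion_coef_flip_lt g s ltkl.
    by have [_ ->] := fermion_coef_flip_lt f s ltkl; ring.
  have [_ ->] := fermion_coef_flip_lt g s ltlk.
  by have [-> _] := fermion_coef_flip_lt f s ltlk; ring.
rewrite /GRing.scale /= /pairing mulr_sumr mulr_suml; apply: eq_bigr => k _.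
rewrite (bigD1 k) //= big1 ?addr0 => [|l lk]; last by rewrite T0 // eq_sym.
have km := ltn_ord k.
rewrite /T flipK /fermion_coef spin_at_flip_gt // spin_at_flip_le ?(ltnW km) // rmorphN /=.
have e1 : (spin_at s k.+1)%:C ^+ 2 = 1 by rewrite -rmorphXn expr2 spin_at_sqr.
have e2 : (spin_at s k)%:C ^+ 2 = 1 by rewrite -rmorphXn expr2 spin_at_sqr.
set p := (spin_at s k.+1)%:C in e1 *; set q := (spin_at s k)%:C in e2 *.
transitivity ((2 * (f (k, ord0) + f (k, ord_max)) * (g (k, ord0) + g (k, ord_max)) * p ^+ 2
  - 2 * (f (k, ord0) - f (k, ord_max)) * (g (k, ord0) - g (k, ord_max)) * q ^+ 2) * x s).
  by ring.
by rewrite e1 e2; ring.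
Qed.

End Fermions.

Section TransferFermion.
Variables (R : realType) (a b : int) (beta : R).
Local Notation m := (`|b - a|%N).
Local Notation config := {ffun 'I_m.+1 -> bool}.
Local Notation S := {ffun config -> R[i]^o}.
Local Notation X := {ffun 'I_m * 'I_2 -> R[i]^o}.

Lemma fermion_Splus f (x : S) : x \in Splus R a b -> fermion f x \in Splus R a b.
Proof.
move=> xU; apply/basis_vec_spanP => s sm; rewrite fermionE big1 // => k _.
rewrite (basis_vec_spanP _ _ xU) ?mulr0 // ffunE leqNgt.
by rewrite (ltn_ord k).
Qed.

(* Flipping the spins up to [k] changes the energy of the [k]-th bond only. *)
Lemma Vh_half_fermion (f g : X) (x : S) :
    (forall k, g (k, ord0) = (expR (- beta))%:C * f (k, ord0)) ->
    (forall k, g (k, ord_max) = (expR beta)%:C * f (k, ord_max)) ->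
  matrix_op (@Vh_half_entry R a b beta) (fermion f x)
  = fermion g (matrix_op (@Vh_half_entry R a b beta) x).
Proof.
move=> g0 g1.
pose h (s : config) := expR (beta / 2 * \sum_(i < m) spin_at R s i * spin_at R s i.+1).
have hE (y : S) s : matrix_op (@Vh_half_entry R a b beta) y s = (h s)%:C * y s.
  rewrite matrix_opE (bigD1 s) //= big1 ?addr0 => [|t ts]; last first.
    by rewrite /Vh_half_entry eq_sym (negPf ts) mul0r.
  rewrite /Vh_half_entry eqxx /h; congr ((expR (_ * _))%:C * _); apply: eq_bigr => i _.
  rewrite /spin_at; congr (spin R (s _) * spin R (s _)); apply: val_inj.
    by rewrite /= inordK // ltnS ltnW.
  by rewrite /= inordK ?ltnS.
have hflip (k : 'I_m) s : h (flip_left k s)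
    = h s * expR (- (beta * (spin_at R s k * spin_at R s k.+1))).
  rewrite /h -expRD; congr expR.
  rewrite (bigD1 k) //= [in RHS](bigD1 k) //=.
  have km := ltn_ord k.
  rewrite spin_at_flip_le ?(ltnW km) // spin_at_flip_gt //.
  rewrite (eq_bigr (fun i : 'I_m => spin_at R s i * spin_at R s i.+1)) => [|i ik].
    by field.
  have im := ltn_ord i.
  have [ltki|ltik|ki] := ltngtP k i; last by rewrite (val_inj ki) eqxx in ik.
    by rewrite !spin_at_flip_gt ?(ltnW im) // (leq_trans ltki).
  by rewrite !spin_at_flip_le ?(ltnW im) ?(ltnW ltik) // mulrNN.
apply/ffunP => s; rewrite hE !fermionE mulr_sumr; apply: eq_bigr => k _.
rewrite hE hflip rmorphM !mulrA; congr (_ * _).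
rewrite /fermion_coef g0 g1 [RHS]mulrAC [RHS]mulrC mulrA -mulrA; congr (_ * _).
have EE : (expR beta)%:C * (expR (- beta))%:C = 1.
  by rewrite -rmorphM -expRD subrr expR0.
(* Equal neighbouring spins leave only [f (k, ord_max)] in the coefficient, opposite ones only
   [f (k, ord0)]; the scaling of that entry compensates the change of energy. *)
rewrite /spin_at; case: (s (inord k)); case: (s (inord k.+1));
  rewrite /spin ?(mulr1, mulrN1, mulrN, opprK, mul1r) ?rmorphN ?rmorph1 /=.
- transitivity (2 * f (k, ord_max) * ((expR beta)%:C * (expR (- beta))%:C));
    by [rewrite EE; ring | ring].
- transitivity (- 2 * f (k, ord0) * ((expR beta)%:C * (expR (- beta))%:C));
    by [rewrite EE; ring | ring].
- transitivity (2 * f (k, ord0) * ((expR beta)%:C * (expR (- beta))%:C));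
    by [rewrite EE; ring | ring].
- transitivity (- 2 * f (k, ord_max) * ((expR beta)%:C * (expR (- beta))%:C));
    by [rewrite EE; ring | ring].
Qed.

(* The kernels of the two sides differ by a telescoping sum over the sites. *)
Lemma Vv_fermion (f g : X) (x : S) (u v : nat -> R[i]) (al := (alpha beta)%:C) :
    u 0%N = 0 -> v m = 0 ->
    (forall k : 'I_m,
      [/\ f (k, ord0) + f (k, ord_max) = u k.+1 - al * v k.+1,
          f (k, ord0) - f (k, ord_max) = v k - al * u k,
          g (k, ord0) + g (k, ord_max) = u k.+1 + al * v k.+1
        & g (k, ord0) - g (k, ord_max) = al * u k + v k]) ->
  matrix_op (@Vv_entry R a b beta) (fermion f x)
  = fermion g (matrix_op (@Vv_entry R a b beta) x).
Proof.
move=> u0 vm fg; apply/ffunP => s; rewrite matrix_opE fermionE.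
under eq_bigr do rewrite fermionE mulr_sumr.
under [RHS]eq_bigr do rewrite matrix_opE mulr_sumr.
rewrite [RHS]exchange_big /= exchange_big /=.
under eq_bigr => k _.
  rewrite (reindex_inj (can_inj (flipK k))) /=.
  under eq_bigr do rewrite flipK mulrA.
  over.
rewrite exchange_big; apply: eq_bigr => r _ /=.
under [RHS]eq_bigr do rewrite mulrA.
rewrite -!mulr_suml; congr (_ * _).
(* Flipping the left part of [r] or of [s] gives the same products of spins, so the entries of
   [Vv_entry] on both sides share the weight [E k]. *)
pose E n := expR (beta * \sum_(i < m.+1) spin R (flip_left n s i) * spin R (r i)).
have VE (k : 'I_m) (s1 s2 : config) :
    (forall i, spin R (s1 i) * spin R (s2 i) = spin R (flip_left k s i) * spin R (r i)) ->
    (s1 ord0 == s2 ord0) = (~~ s ord0 == r ord0) ->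
    (s1 ord_max == s2 ord_max) = (s ord_max == r ord_max) ->
  @Vv_entry R a b beta s1 s2 = if (~~ s ord0 == r ord0) && (s ord_max == r ord_max) then E k else 0.
  move=> e1 e2 e3; rewrite /Vv_entry e2 e3; case: ifP => // _; rewrite /E; congr expR.
  by congr (_ * _); apply: eq_bigr => i _; rewrite e1.
have maxk (k : 'I_m) (t : config) : flip_left k t ord_max = t ord_max.
  by rewrite ffunE leqNgt (ltn_ord k).
have VE1 (k : 'I_m) : @Vv_entry R a b beta s (flip_left k r)
    = if (~~ s ord0 == r ord0) && (s ord_max == r ord_max) then E k else 0.
  apply: VE; rewrite ?maxk //.
    by move=> i; rewrite !ffunE; case: ifP; rewrite // !spinN mulrN mulNr.
  by rewrite ffunE /=; case: (s ord0); case: (r ord0).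
have VE2 (k : 'I_m) : @Vv_entry R a b beta (flip_left k s) r
    = if (~~ s ord0 == r ord0) && (s ord_max == r ord_max) then E k else 0.
  by apply: VE; rewrite ?maxk // ffunE.
under eq_bigr do rewrite VE1; under [RHS]eq_bigr do rewrite VE2.
case: (boolP (_ && _)) => [/andP[/eqP sr0 /eqP srm]|_]; last first.
  by rewrite !big1 // => k _; rewrite ?(mul0r, mulr0).
have inordM : inord m = ord_max :> 'I_m.+1 by apply: val_inj; rewrite /= inordK.
have inord0 : inord 0 = ord0 :> 'I_m.+1 by apply: val_inj; rewrite /= inordK.
have Estep n : (n < m)%N ->
    E n.+1 = E n * expR (- 2 * beta * (spin_at R s n.+1 * spin_at R r n.+1)).
  move=> nm; have nE : (inord n.+1 : 'I_m.+1) = n.+1 :> nat by rewrite inordK.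
  rewrite /E -expRD; congr expR.
  rewrite (bigD1 (inord n.+1)) //= [in RHS](bigD1 (inord n.+1)) //=.
  rewrite !ffunE nE leqnn ltnn spinN -/(spin_at R s _) -/(spin_at R r _).
  rewrite (eq_bigr (fun i => spin R (flip_left n s i) * spin R (r i))) => [|i iN].
    by ring.
  rewrite !ffunE [(i <= n.+1)%N]leq_eqVlt ltnS.
  rewrite (_ : (val i == n.+1) = false) //; apply: contraNF iN => /eqP iE.
  by apply/eqP/val_inj; rewrite /= nE.
(* [F] vanishes on the left because [u 0 = 0] and the spins of [s] and [r] are opposite there, and
   on the right because [v m = 0] and the spins agree. *)
pose F n := (E n)%:C *
  ((al * u n - v n) * (spin_at R r n)%:C - (al * u n + v n) * (spin_at R s n)%:C).
transitivity (\sum_(k < m) (F k.+1 - F k) + \sum_(k < m) fermion_coef g k s * (E k)%:C).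
  rewrite -big_split; apply: eq_bigr => k _ /=.
  have [e1 e2 e3 e4] := fg k; have km := ltn_ord k.
  rewrite /fermion_coef spin_at_flip_gt // spin_at_flip_le ?(ltnW km) // rmorphN /= e1 e2 e3 e4.
  rewrite /F Estep // rmorphM /=.
  have EE : (expR (2 * beta))%:C * al = 1 by rewrite -rmorphM -expRD mulNr subrr expR0.
  rewrite /spin_at; case: (s (inord k.+1)); case: (r (inord k.+1));
    rewrite /spin ?(mulrNN, mulrN1, mulr1) ?mulNr ?opprK;
    rewrite ?rmorphN ?rmorph1 /= -?[- (2 * beta)]mulNr -/(alpha beta) -/al; ring: EE.
rewrite sum_telescope /F u0 vm /spin_at inordM inord0 -sr0 srm spinN rmorphN /=.
by ring.
Qed.

Hypotheses (ab : a < b) (beta_gt0 : 0 < beta).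

(** The outer factors rescale the two components of each entry, the middle one performs the
    transport. Multiplying [u] and [v] by [expR beta] absorbs the rescaling, as [expR (- beta)] is
    [expR beta] times [alpha beta]. *)
Lemma transfer_fermion (f : X) (x : S) :
  transfer a b beta (fermion f x) = fermion (propagatorC a b beta f) (transfer a b beta x).
Proof.
set P := propagatorC a b beta.
pose scale (c d : R) (h : X) : X :=
  [ffun j => (if j.2 == ord0 then c else d)%:C * h j].
pose f1 := scale (expR (- beta)) (expR beta) f.
pose g1 := scale (expR beta) (expR (- beta)) (P f).
have [u [v [u0 vm T]]] := propagatorC_transport ab beta_gt0 f.
have EE : (expR beta)%:C * (expR (- beta))%:C = 1 by rewrite -rmorphM -expRD subrr expR0.
have alE : (expR (- beta))%:C = (expR beta)%:C * (alpha beta)%:C.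
  by rewrite -rmorphM -expRD; congr (expR _)%:C; ring.
rewrite /transfer !comp_lfunE.
rewrite (@Vh_half_fermion f f1) => [|k|k]; try by rewrite ffunE.
rewrite (@Vv_fermion f1 g1 _ (fun n => (expR beta)%:C * u n) (fun n => (expR beta)%:C * v n)).
- rewrite (@Vh_half_fermion g1 (P f)) // => k; rewrite ffunE /= mulrA.
    by rewrite [X in X * _]mulrC EE mul1r.
  by rewrite EE mul1r.
- by rewrite u0 mulr0.
- by rewrite vm mulr0.
move=> k; have [e1 e2 e3 e4] := T k; rewrite !ffunE /= -/P alE.
split.
- transitivity ((expR beta)%:C * (u k.+1 - (alpha beta)%:C * v k.+1)); last by ring.
  by rewrite -e1; ring.
- transitivity ((expR beta)%:C * (v k - (alpha beta)%:C * u k)); last by ring.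
  by rewrite -e2; ring.
- transitivity ((expR beta)%:C * (u k.+1 + (alpha beta)%:C * v k.+1)); last by ring.
  by rewrite -e3; ring.
transitivity ((expR beta)%:C * ((alpha beta)%:C * u k + v k)); last by ring.
by rewrite -e4; ring.
Qed.

End TransferFermion.

(** * Isomorphisms that match eigenbases *)

Section EigenbasisIso.
Variables (K : fieldType) (I : finType) (U1 U2 : vectType K).

Definition independent (U : vectType K) (e : I -> U) : Prop :=
  forall k : I -> K, \sum_i k i *: e i = 0 -> forall i, k i = 0.

Definition spanning (U : vectType K) (E : {vspace U}) (e : I -> U) : Prop :=
  forall x, x \in E -> exists k : I -> K, x = \sum_i k i *: e i.

Lemma independent_inj (U : vectType K) (e : I -> U) (k k' : I -> K) :
  independent e -> \sum_i k i *: e i = \sum_i k' i *: e i -> k =1 k'.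
Proof.
move=> ind /eqP; rewrite -subr_eq0 -sumrB => /eqP kk i.
apply/eqP; rewrite -subr_eq0; apply/eqP; apply: (ind (fun i => k i - k' i)).
by rewrite -[RHS]kk; apply: eq_bigr => j _; rewrite scalerBl.
Qed.

Lemma independent_spanning (U : vectType K) (E : {vspace U}) (e : I -> U) :
  independent e -> (forall i, e i \in E) -> (\dim E <= #|I|)%N -> spanning E e.
Proof.
move=> ind eE dimE; pose X := [tuple e (enum_val i) | i < #|I|].
have Xi (i : 'I_#|I|) : X`_i = e (enum_val i) by rewrite -tnth_nth tnth_mktuple.
have sumX (k : 'I_#|I| -> K) :
    \sum_i k i *: X`_i = \sum_i k (enum_rank i) *: e i.
  rewrite [RHS](reindex (enum_val : 'I_#|I| -> I)) /=; last exact/onW_bij/enum_val_bij.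
  by apply: eq_bigr => i _; rewrite Xi enum_valK.
have bX : basis_of E X.
  rewrite basisEfree size_tuple dimE andbT; apply/andP; split.
    apply/freeP => k; rewrite sumX => /ind k0 i.
    by have := k0 (enum_val i); rewrite enum_valK.
  by apply/span_subvP => x /tnthP[i ->]; rewrite tnth_mktuple eE.
move=> x /(coord_basis bX) ->; rewrite sumX.
by exists (fun i => coord X (enum_rank i) x).
Qed.

Section Iso.
Variables (E : {vspace U1}) (F : {vspace U2}) (e : I -> U1) (g : I -> U2).
Hypotheses (e_ind : independent e) (e_span : spanning E e) (eE : forall i, e i \in E).
Hypotheses (g_ind : independent g) (g_span : spanning F g) (gF : forall i, g i \in F).

Lemma change_basis : exists2 rho : 'Hom(subvs_of E, subvs_of F), bijective rho
  & forall x (k : I -> K), vsval x = \sum_i k i *: e i ->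
      vsval (rho x) = \sum_i k i *: g i.
Proof.
have [k kP] := choice (fun x : subvs_of E => e_span (subvsP x)).
have [h hP] := choice (fun y : subvs_of F => g_span (subvsP y)).
have sumE (c : I -> K) : \sum_i c i *: e i \in E.
  by apply: rpred_sum => i _; apply: rpredZ.
have sumF (c : I -> K) : \sum_i c i *: g i \in F.
  by apply: rpred_sum => i _; apply: rpredZ.
pose r (x : subvs_of E) : subvs_of F := vsproj F (\sum_i k x i *: g i).
have rlin : linear r.
  move=> c x y; apply: val_inj; rewrite /r !linearP /=.
  rewrite !vsprojK // scaler_sumr -big_split; apply: eq_bigr => i _ /=.
  rewrite scalerA -scalerDl; congr (_ *: _).
  apply: (independent_inj e_ind (k := k (c *: x + y)) (k' := fun i => c * k x i + k y i)).
  rewrite -kP linearP /= !kP scaler_sumr -big_split; apply: eq_bigr => j _ /=.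
  by rewrite scalerA -scalerDl.
have rE x (c : I -> K) : vsval x = \sum_i c i *: e i ->
    vsval (linfun r x) = \sum_i c i *: g i.
  move=> xc; rewrite linfunE // vsprojK //; apply: eq_bigr => i _.
  by rewrite (independent_inj e_ind (k := k x) (k' := c)) // -kP.
exists (linfun r) => //.
exists (fun y => vsproj E (\sum_i h y i *: e i)) => [x|y]; apply: val_inj.
  rewrite /= vsprojK // kP; apply: eq_bigr => i _; congr (_ *: _).
  by apply: (independent_inj g_ind); rewrite -hP (rE _ _ (kP x)).
by apply: etrans (rE _ (h y) _) _; rewrite ?vsprojK // -hP.
Qed.

Lemma eigenbasis_iso (V : 'End(U1)) (G : 'End(U2)) (c : I -> K) (L : K) :
    (V @: E <= E)%VS -> (G @: F <= F)%VS ->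
    (forall i, V (e i) = (L * c i) *: e i) -> (forall i, G (g i) = c i *: g i) ->
  exists2 rho : 'Hom(subvs_of E, subvs_of F), bijective rho
    & (rho \o restr E V \o rho^-1)%VF = L *: restr F G.
Proof.
move=> VE GF Ve Gg; have [rho rho_bij rhoE] := change_basis.
exists rho => //; have ker0 : lker rho == 0%VS.
  by apply/lker0P; exact: bij_inj.
apply/lfunP => y; have [rho' _ rho'K] := rho_bij.
rewrite -(rho'K y) !comp_lfunE lker0_lfunK // scale_lfunE.
move: (rho' y) => {y} x; apply: val_inj => /=.
have [k xk] := e_span (subvsP x).
rewrite (rhoE _ (fun i => k i * (L * c i))); last first.
  rewrite restrE // xk linear_sum; apply: eq_bigr => i _.
  by rewrite linearZ /= Ve scalerA.
rewrite restrE // (rhoE _ _ xk) linear_sum scaler_sumr; apply: eq_bigr => i _.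
by rewrite linearZ /= Gg !scalerA mulrCA mulrA.
Qed.

End Iso.
End EigenbasisIso.

(** * Top eigenvector and dimension of [Splus] *)

Section TopEigenvector.
Variables (R : realType) (a b : int) (beta : R).
Local Notation m := (`|b - a|%N).
Local Notation config := {ffun 'I_m.+1 -> bool}.
Local Notation S := {ffun config -> R[i]^o}.
Local Notation V := (transfer a b beta).

Lemma matrix_op_sym (M : config -> config -> R) (x y : S) :
    (forall s r, M s r = M r s) ->
  hdot (matrix_op M x) y = hdot x (matrix_op M y).
Proof.
move=> Msym; rewrite /hdot.
under eq_bigr do rewrite matrix_opE mulr_suml.
under [RHS]eq_bigr do rewrite matrix_opE rmorph_sum mulr_sumr.
rewrite exchange_big; apply: eq_bigr => s _; apply: eq_bigr => r _ /=.
by rewrite conjcM (conjc_real (M s r)) Msym mulrCA mulrA.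
Qed.

Lemma Vh_half_sym s r : @Vh_half_entry R a b beta s r = Vh_half_entry beta r s.
Proof. by rewrite /Vh_half_entry eq_sym; case: eqP => // ->. Qed.

Lemma Vv_sym s r : @Vv_entry R a b beta s r = Vv_entry beta r s.
Proof.
rewrite /Vv_entry eq_sym [s ord_max == _]eq_sym; case: ifP => // _.
by congr (expR (_ * _)); apply: eq_bigr => i _; rewrite mulrC.
Qed.

Lemma transfer_sym x y : hdot (V x) y = hdot x (V y).
Proof.
rewrite /transfer !comp_lfunE (matrix_op_sym _ _ Vh_half_sym).
by rewrite (matrix_op_sym _ _ Vv_sym) (matrix_op_sym _ _ Vh_half_sym).
Qed.

Lemma transfer_diag_gt0 s : 0 < V (basis_vec R[i] s) s.
Proof.
have h_gt0 : 0 < @Vh_half_entry R a b beta s s by rewrite /Vh_half_entry eqxx expR_gt0.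
have v_gt0 : 0 < @Vv_entry R a b beta s s by rewrite /Vv_entry !eqxx expR_gt0.
have hE (y : S) r : matrix_op (@Vh_half_entry R a b beta) y r
    = (@Vh_half_entry R a b beta r r)%:C * y r.
  rewrite matrix_opE (bigD1 r) //= big1 ?addr0 // => t tr.
  by rewrite /Vh_half_entry eq_sym (negPf tr) mul0r.
rewrite /transfer !comp_lfunE hE matrix_opE (bigD1 s) //= big1 ?addr0 => [|t ts].
  by rewrite hE ffunE eqxx mulr1 !mulr_gt0 // ltcR.
by rewrite hE ffunE (negPf ts) !mulr0.
Qed.

(** The projection [Pi] onto [Splus] compresses the transfer matrix to a Hermitian operator [H] on
    the full function space, to which the spectral theorem applies and which agrees with it on
    [Splus]. *)
Lemma transfer_top_eigenvector : exists (u : S) (L : R),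
  [/\ u != 0, u \in Splus R a b, 0 < L, V u = L%:C *: u
    & forall x (c : R), x != 0 -> x \in Splus R a b -> V x = c%:C *: x -> c <= L].
Proof.
pose p (s r : config) : R := if (s == r) && s ord_max then 1 else 0.
have p_sym s r : p s r = p r s.
  by rewrite /p eq_sym; case: eqP => // ->.
pose Pi := matrix_op p.
have PiE x s : Pi x s = if s ord_max then x s else 0.
  rewrite matrix_opE (bigD1 s) //= big1 ?addr0 => [|r rs].
    by rewrite /p eqxx /=; case: (s _); rewrite ?mul1r ?mul0r.
  by rewrite /p eq_sym (negPf rs) mul0r.
have Pi_id x : x \in Splus R a b -> Pi x = x.
  move/basis_vec_spanP => x0; apply/ffunP => s; rewrite PiE.
  by case: ifP => // /negbT/x0 ->.
have Pi_in x : Pi x \in Splus R a b.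
  by apply/basis_vec_spanP => s sm; rewrite PiE (negPf sm).
have V_in x : x \in Splus R a b -> V x \in Splus R a b.
  by move=> xS; rewrite (subvP (transfer_Splus a b beta)) // memv_img.
pose H := (Pi \o V \o Pi)%VF.
have HPi x : H x = Pi (V (Pi x)) by rewrite /H 2!comp_lfunE.
have HE x : x \in Splus R a b -> H x = V x.
  by move=> xS; rewrite HPi (Pi_id x) // Pi_id // V_in.
have H_sym x y : hdot (H x) y = hdot x (H y).
  by rewrite !HPi /Pi (matrix_op_sym _ _ p_sym) transfer_sym (matrix_op_sym _ _ p_sym).
pose s0 : config := [ffun _ => true].
have s0S : basis_vec R[i] s0 \in Splus R a b.
  apply/basis_vec_spanP => s sm; rewrite ffunE; case: eqP => // ss0.
  by rewrite ss0 ffunE in sm.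
have [|u [L [u0 L0 Hu Lmax]]] := @hermitian_top_eigenvector R _ H s0 H_sym.
  by rewrite HE // transfer_diag_gt0.
(* Since [L] is nonzero, [u] is a multiple of [H u] and so lies in the range of [Pi]. *)
have uS : u \in Splus R a b.
  have LC0 : L%:C != 0 by rewrite (inj_eq (@complexI R)) gt_eqF.
  by rewrite -(scale1r u) -(mulVf LC0) -scalerA -Hu memvZ // HPi Pi_in.
exists u, L; split=> // [|x c x0 xS Vx]; first by rewrite -HE.
by apply: (Lmax x) => //; rewrite HE.
Qed.

Lemma dim_Splus : (\dim (Splus R a b) <= 2 ^ m)%N.
Proof.
apply: (leq_trans (dimv_leq_sum _ _ _)).
pose A := [set s : config | s ord_max].
apply: (@leq_trans #|A|).
  rewrite -sum1dep_card; apply: leq_sum => s _.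
  by rewrite dim_vline; case: (_ != 0).
(* [flip_left m] reverses all spins, so it sends [A] injectively into its complement. *)
have cA : (#|A| <= #|~: A|)%N.
  rewrite -(card_imset _ (can_inj (@flipK m m))) subset_leq_card //.
  apply/subsetP => _ /imsetP[s sA ->]; rewrite !inE ffunE leq_ord.
  by move: sA; rewrite inE => ->.
rewrite -(leq_pmul2l (isT : 0 < 2)%N) -expnS mul2n -addnn.
apply: leq_trans (leq_add (leqnn _) cA) _.
by rewrite cardsC card_ffun card_bool card_ord.
Qed.

End TopEigenvector.

(** * Matching Fock vectors with wedge products *)

Theorem theorem18 (R : realType) (a b : int) (beta : R) (hab : a < b)
    (hbeta : 0 < beta) :
  exists (rho : 'Hom(subvs_of (Splus R a b),
                     subvs_of (extalg `|b - a|%N (Wcirc a b beta))))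
         (Lambda0 : R),
    [/\ bijective rho, 0 < Lambda0
      & (rho \o restr (Splus R a b) (transfer a b beta) \o rho^-1)%VF
        = Lambda0%:C *: restr (extalg `|b - a|%N (Wcirc a b beta))
                              (Gamma `|b - a|%N (propagatorC a b beta))].
Proof.
have [w [w' [mu [mu01 Pw Pw' ww WE]]]] := propagatorC_spectrum hab hbeta.
have [vac [L [vac0 vacS L0 Vvac Lmax]]] := transfer_top_eigenvector a b beta.
set m := `|b - a|%N in w w' mu mu01 Pw Pw' ww WE vac vac0 vacS Vvac Lmax *.
pose c (i : 'I_m) := @fermion R m (w i).
(* The factor [4^-1] cancels the constant in [fermion_anticommute]. *)
pose c' (i : 'I_m) := 4^-1 *: @fermion R m (w' i).
have four0 : (4 : R[i]) != 0 by rewrite pnatr_eq0.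
have cc i j x : c i (c j x) + c j (c i x) = 0.
  by rewrite fermion_anticommute (ww i j).1 mulr0 scale0r.
have cc' i j x : c i (c' j x) + c' j (c i x) = (i == j)%:R *: x.
  rewrite !scale_lfunE linearZ /= -scalerDr fermion_anticommute (ww i j).2 scalerA.
  by rewrite mulrA mulVf // mul1r.
have ferS f x : x \in Splus R a b -> @fermion R m f x \in Splus R a b.
  exact: fermion_Splus.
have c'vac i : c' i vac = 0.
  rewrite scale_lfunE; suff -> : fermion (w' i) vac = 0 by rewrite scaler0.
  apply/eqP; apply: contraT => y0.
  have := Lmax _ ((mu i)^-1 * L) y0 (ferS _ _ vacS).
  rewrite transfer_fermion // Vvac Pw' fermionZ linearZ scalerA -rmorphM => /(_ erefl).
  rewrite -ler_pdivlMr // divff ?gt_eqF // leNgt invf_gt1 ?(andP (mu01 i)).1 //.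
  by rewrite (andP (mu01 i)).2.
have Vc i x : transfer a b beta (c i x) = (mu i)%:C *: c i (transfer a b beta x).
  by rewrite /c transfer_fermion // Pw fermionZ.
have wordS s : fock_word c vac s \in Splus R a b.
  by elim: s => [|i s IH] //=; apply: ferS.
have fock_ind : independent (fock c vac) by exact: fock_free cc cc' c'vac vac0.
have w_dual : exists l : 'I_m -> 'I_m * 'I_2 -> R[i],
    forall i j, \sum_x l i x * w j x = (i == j)%:R.
  (* Reversing the second index turns [pairing] into the coordinatewise sum, so [w'] supplies the
     dual functionals. *)
  exists (fun i x => w' i (x.1, rev_ord x.2)) => i j.
  rewrite eq_sym -(ww j i).2 sum_row; apply: eq_bigr => k _ /=.
  have -> : rev_ord (@ord0 1) = ord_max by exact: val_inj.
  have -> : rev_ord (@ord_max 1) = ord0 by exact: val_inj.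
  by rewrite mulrC; congr (_ + _); rewrite mulrC.
(* By this bound the independent Fock vectors, one for each of the [2 ^ m] sets of indices, span
   [Splus]. *)
have dimS : (\dim (Splus R a b) <= #|{set 'I_m}|)%N.
  apply: leq_trans (dim_Splus R a b) _.
  by rewrite -(cardsT {set 'I_m}) -powersetT card_powerset cardsT card_ord.
have [rho rho_bij rhoV] := @eigenbasis_iso R[i] {set 'I_m} _ _
  (Splus R a b) (extalg m (Wcirc a b beta)) (fock c vac) (ext_vec m w)
  fock_ind (independent_spanning fock_ind (fun A => wordS _) dimS) (fun A => wordS _)
  (ext_vec_free (leqnn m) w_dual) (extalg_span WE) (ext_vec_extalg m WE)
  (transfer a b beta) (Gamma m (propagatorC a b beta))
  (fun A => \prod_(i <- enum A) (mu i)%:C) L%:C (transfer_Splus a b beta)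
  (Gamma_extalg m (@Wcirc_stable R a b beta))
  (fun A => fock_eigen (enum A) Vc Vvac) (fun A => Gamma_ext_vec m A Pw).
by exists rho, L.
Qed.
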